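(* Let $N \geq 2$ and let $\boldsymbol{X}$ be a $d$-dimensional random vector following a multivariate normal distribution with mean $\boldsymbol{\mu}$ and (symmetric positive definite) covariance matrix $\boldsymbol{\Sigma}$. Partition $\boldsymbol{X}$ into $N$ subvectors $(\boldsymbol{X}_1, \dots, \boldsymbol{X}_N)$, partition $\boldsymbol{\Sigma}$ accordingly into blocks $\boldsymbol{\Sigma}_{mn}$, $1 \le m,n \le N$, and let $i_d = i_d(\boldsymbol{X}; \boldsymbol{X}_1, \dots, \boldsymbol{X}_N)$ be the corresponding multiinformation density and $I(\boldsymbol{X}_1; \dots; \boldsymbol{X}_N)$ the corresponding multiinformation. Set $$\boldsymbol{\Gamma} = \boldsymbol{\Sigma} \, \mathrm{diag}(\boldsymbol{\Sigma}_{11}, \dots, \boldsymbol{\Sigma}_{NN})^{-1} - \boldsymbol{I}_d .$$ Then $\boldsymbol{\Gamma}$ is the block matrix whose diagonal blocks are equal to $\boldsymbol{0}$ and whose off-diagonal block $(m,n)$ is the matrix of regression coefficients of $\boldsymbol{X}_m$ on $\boldsymbol{X}_n$, $$\boldsymbol{\Gamma}_{m|n} = \boldsymbol{\Sigma}_{mn} \boldsymbol{\Sigma}_{nn}^{-1}, \qquad m \neq n.$$ The cumulant-generating function of $i_d$ is given, for all real $t$ in some open neighborhood of $0$, by $$\ln \mathrm{E}\left( e^{t\, i_d} \right) = t \, I(\boldsymbol{X}_1; \dots; \boldsymbol{X}_N) - \frac{1}{2} \ln | \boldsymbol{I}_d - t \boldsymbol{\Gamma} | ,$$ and the cumulants of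 $i_d$ are given by $$\kappa_1(i_d) = I(\boldsymbol{X}_1; \dots; \boldsymbol{X}_N) \qquad \text{and} \qquad \kappa_l(i_d) = \frac{(l-1)!}{2} \, \mathrm{tr}\left( \boldsymbol{\Gamma}^l \right) \quad \text{for all integers } l \geq 2.$$
   Context: Let $f$ be the probability density of $\boldsymbol{X}$ on $\mathbb{R}^d$ and $f_n$ the marginal density of the subvector $\boldsymbol{X}_n$, $n = 1, \dots, N$. The multiinformation density is the real random variable $$i_d(\boldsymbol{X}; \boldsymbol{X}_1, \dots, \boldsymbol{X}_N) = \ln \left[ \frac{f(\boldsymbol{X})}{\prod_{n=1}^N f_n(\boldsymbol{X}_n)} \right],$$ and the multiinformation is its expectation $$I(\boldsymbol{X}_1; \dots; \boldsymbol{X}_N) = \int f(\boldsymbol{x}) \, \ln \left[ \frac{f(\boldsymbol{x})}{\prod_{n=1}^N f_n(\boldsymbol{x}_n)} \right] \mathrm{d}\boldsymbol{x}.$$ Notation: $\ln$ is the natural logarithm; $|\boldsymbol{A}|$ is the determinant and $\mathrm{tr}(\boldsymbol{A})$ the trace of a square matrix $\boldsymbol{A}$; $\boldsymbol{I}_d$ is the $d \times d$ identity matrix; $\boldsymbol{\Sigma}_{mn}$ is the matrix of covariances between $\boldsymbol{X}_m$ and $\boldsymbol{X}_n$; $\mathrm{diag}(\boldsymbol{\Sigma}_{11}, \dots, \boldsymbol{\Sigma}_{NN})$ is the block-diagonal matrix with diagonal blocks $\boldsymbol{\Sigma}_{11}, \dots, \boldsymbol{\Sigma}_{NN}$. The subscript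 $d$ in the symbol $i_d$ is part of the name (''density'') and is not the dimension $d$. The cumulants $\kappa_l(Y)$ of a random variable $Y$ are the coefficients in the expansion $\ln \mathrm{E}(e^{tY}) = \sum_{l \geq 1} \kappa_l(Y) \, t^l / l!$ near $t = 0$. *)

(* Defs.v *)
From HB Require Import structures.
From mathcomp Require Import all_boot all_order all_algebra.
From mathcomp Require Import all_classical all_reals all_analysis.

Set Implicit Arguments.
Unset Strict Implicit.
Unset Printing Implicit Defensive.

Import Order.TTheory GRing.Theory Num.Theory.
Import numFieldNormedType.Exports.

Local Open Scope classical_set_scope.
Local Open Scope ring_scope.

Section lebesgue_tuple.
Context {R : realType}.

(* lebesgue_measure lives on measurableTypeR R, a copy of R whose sigma-algebra
   is convertible to that of R but has another display; hence the type of x. *)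
Definition tcons n (x : measurableTypeR R * n.-tuple R) : n.+1.-tuple R :=
  [tuple of (x.1 : R) :: x.2].

Lemma measurable_tcons n : measurable_fun setT (@tcons n).
Proof.
exact: (@measurable_cons _ _ _ R _ n _ measurable_fst measurable_snd).
Qed.

Section step.
Variables (n : nat) (m : {sigma_finite_measure set (n.-tuple R) -> \bar R}).

Definition tcons_measure : set (n.+1.-tuple R) -> \bar R :=
  pushforward (lebesgue_measure \x m)%E (@tcons n).

Let tcons_measure0 : tcons_measure set0 = 0%E.
Proof. by apply: measure0; exact: measurable_tcons. Qed.

Let tcons_measure_ge0 A : (0 <= tcons_measure A)%E.
Proof. by apply: measure_ge0; exact: measurable_tcons. Qed.

Let tcons_measure_sigma_additive : semi_sigma_additive tcons_measure.
Proof. by apply: measure_semi_sigma_additive; exact: measurable_tcons. Qed.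

HB.instance Definition _ := isMeasure.Build _ _ _ tcons_measure
  tcons_measure0 tcons_measure_ge0 tcons_measure_sigma_additive.

Let tcons_measure_sigma_finite : sigma_finite setT tcons_measure.
Proof.
have /sigma_finiteP[F [TF ndF Foo]] := sigma_finiteT (lebesgue_measure :
  {sigma_finite_measure set (measurableTypeR R) -> \bar R}).
have /sigma_finiteP[G [TG ndG Goo]] := sigma_finiteT m.
pose s (y : n.+1.-tuple R) : measurableTypeR R * n.-tuple R :=
  (thead y, [tuple of behead y]).
have sK : cancel (@tcons n) s by case=> x y; congr pair; exact: val_inj.
have ms : measurable_fun setT s.
  apply/measurable_fun_pair; last exact: measurable_behead.
  exact: (@measurable_tnth _ R n.+1 ord0).
exists (fun i => s @^-1` (F i `*` G i)).
  apply/esym; rewrite -subTset => y _.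
  have [i _ Fi] : (\bigcup_k F k) (s y).1 by rewrite -TF.
  have [k _ Gk] : (\bigcup_k G k) (s y).2 by rewrite -TG.
  exists (maxn i k) => //; split.
  - by move: Fi; exact/subsetPset/ndF/leq_maxl.
  - by move: Gk; exact/subsetPset/ndG/leq_maxr.
move=> i; have [mF Fi] := Foo i; have [mG Gi] := Goo i; split.
  by rewrite -[X in measurable X]setTI; apply: ms => //; exact: measurableX.
rewrite /tcons_measure /pushforward -comp_preimage.
have -> : s \o @tcons n = id by apply/funext => x /=; rewrite sK.
by rewrite preimage_id product_measure1E// lte_mul_pinfty// ge0_fin_numE.
Qed.

HB.instance Definition _ := Measure_isSigmaFinite.Build _ _ _ tcons_measure
  tcons_measure_sigma_finite.
End step.

Fixpoint lebesgue_tuple n : {sigma_finite_measure set (n.-tuple R) -> \bar R} :=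
  match n with
  | 0 => \d_[tuple]
  | n'.+1 => tcons_measure (lebesgue_tuple n')
  end.

Lemma lebesgue_tuple_box n (A : 'I_n -> set R) :
    (forall i, measurable (A i)) ->
  lebesgue_tuple n [set x | forall i, A i (tnth x i)] =
  (\prod_(i < n) lebesgue_measure (A i))%E.
Proof.
elim: n A => [|n IH] A mA /=.
  by rewrite big_ord0 diracE mem_set// => -[].
rewrite big_ord_recl /= -IH; last by move=> i; exact: mA.
rewrite /tcons_measure /pushforward /= -product_measure1E; last 2 first.
- exact: mA.
- rewrite (_ : [set x | _] = \bigcap_i 
    (if insub i is Some j then (@tnth n R ^~ j) @^-1` A (lift ord0 j) else setT)).
    apply: bigcapT_measurable => i.
    case: insub => [j|]; last exact: measurableT.
    rewrite -[X in measurable X]setTI; apply: measurable_tnth => //; exact: mA.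
  apply/seteqP; split => x /=.
    by move=> Ax i _; case: insub => // j; exact: Ax.
  by move=> Ax i; have := Ax i I; rewrite insubT//= => ilt; rewrite (_ : Sub _ _ = i) //; exact: val_inj.
congr ((lebesgue_measure \x lebesgue_tuple n) _)%E.
apply/seteqP; split => -[x y] /=.
  move=> Axy; split; first by have := Axy ord0; rewrite /tcons tnth0.
  by move=> i; have := Axy (lift ord0 i); rewrite /tcons tnthS.
move=> [Ax Ay] i; rewrite /tcons; case: (unliftP ord0 i) => [j|] ->.
  by rewrite tnthS.
by rewrite tnth0.
Qed.
End lebesgue_tuple.

Section multinormal.
Context {R : realType}.

Definition posdefmx n (S : 'M[R]_n) :=
  S^T = S /\ forall v : 'cV[R]_n, v != 0 -> 0 < (v^T *m S *m v) 0 0.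

Definition col_of_tuple n (x : n.-tuple R) : 'cV[R]_n := \col_i tnth x i.

Definition multinormal_pdf n (mu : 'cV[R]_n) (S : 'M[R]_n) (x : n.-tuple R) : R :=
  let v := col_of_tuple x - mu in
  expR (- (v^T *m invmx S *m v) 0 0 / 2) / Num.sqrt ((2 * pi) ^+ n * \det S).

Context {d} {T : measurableType d} (P : probability T R).

(* f is an arbitrary version of the density, which is determined only up to a
   Lebesgue-null set. *)
Definition is_density n (X : {RV P >-> n.-tuple R}) (f : n.-tuple R -> R) :=
  [/\ measurable_fun setT f,
      forall x, 0 <= f x &
      forall A, measurable A ->
        distribution P X A = (\int[lebesgue_tuple n]_(x in A) (f x)%:E)%E].

Definition multinormal n (X : {RV P >-> n.-tuple R}) (mu : 'cV[R]_n)
  (S : 'M[R]_n) := is_density X (multinormal_pdf mu S).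

End multinormal.
Arguments is_density {R d T} P [n] X f.
Arguments multinormal {R d T} P [n] X mu S.

Section subvector.
Context {R : realType} {N : nat} (p : 'I_N -> nat).

(* tagnat.Rank n i is the position of the i-th coordinate of the n-th block;
   it is the indexing used by submxblock and \mxdiag. *)
Definition subvec (n : 'I_N) (x : (\sum_(n < N) p n).-tuple R) :
  (p n).-tuple R := [tuple tnth x (@tagnat.Rank N p n i) | i < p n].

Lemma measurable_subvec n : measurable_fun setT (@subvec n).
Proof.
apply/measurable_fun_tnthP => i.
rewrite (_ : _ \o _ = @tnth _ R ^~ (@tagnat.Rank N p n i)).
  exact: measurable_tnth.
by apply/funext => x /=; rewrite /subvec tnth_mktuple.
Qed.

HB.instance Definition _ n :=
  isMeasurableFun.Build _ _ _ _ (@subvec n) (@measurable_subvec n).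

Lemma subvec_col n x :
  col_of_tuple (subvec n x) = submxcol (col_of_tuple x) n.
Proof. by apply/matrixP => i j; rewrite !mxE tnth_mktuple. Qed.

End subvector.
Arguments subvec {R N} p n x.

Section multiinformation.
Context {R : realType} {N : nat} {p : 'I_N -> nat}.
Variables (f : (\sum_(n < N) p n).-tuple R -> R)
  (fn : forall n, (p n).-tuple R -> R).

(* Where a density vanishes, the values x / 0 = 0 and ln 0 = 0 are used; this
   has probability 0 under f, and f x * log_ratio x = 0 when f x = 0. *)
Definition log_ratio (x : (\sum_(n < N) p n).-tuple R) : R :=
  ln (f x / \prod_(n < N) fn (subvec p n x)).

Definition multiinfo_density (T : Type) (X : T -> (\sum_(n < N) p n).-tuple R) :
  T -> R := fun w => log_ratio (X w).

Definition multiinfo : \bar R :=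
  (\int[lebesgue_tuple (\sum_(n < N) p n)]_x (f x * log_ratio x)%:E)%E.

End multiinformation.

Section cumulants.
Context {d} {T : measurableType d} {R : realType} (P : probability T R).

Definition cgf (Y : T -> R) (t : R) : \bar R := lne ('M_P Y t).

(* k l is the l-th cumulant for l >= 1; the value k 0 plays no role. *)
Definition cumulants (Y : T -> R) (k : nat -> R) :=
  \forall t \near (0 : R), cgf Y t \is a fin_num /\
    (fun n => \sum_(1 <= l < n) k l * t ^+ l / l`!%:R) @ \oo --> fine (cgf Y t).

End cumulants.

(* Main.v *)
Require Import Defs.
From mathcomp Require Import all_boot all_order all_algebra all_fingroup.
From mathcomp Require Import all_classical all_reals all_analysis.
From mathcomp Require Import measurable_realfun ring lra.

Import Order.TTheory GRing.Theory Num.Theory.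
Import numFieldNormedType.Exports.

Local Open Scope classical_set_scope.
Local Open Scope ring_scope.

(** Let D be the block-diagonal part of Sigma and v = x - mu.  The marginal of
    a normal vector on a block of coordinates is normal with the corresponding
    block of Sigma as covariance matrix, and a density is determined up to a
    Lebesgue-null set.  Hence, almost everywhere, i_d(x) = c + Q(v) where
    Q(v) = - v^T (Sigma^-1 - D^-1) v / 2 and c is the logarithm of a quotient
    of normalising constants.

    Exponential tilting gives the moment-generating function of Q.  Put
    A = Sigma^-1 + t (Sigma^-1 - D^-1).  The normal density of covariance Sigma
    multiplied by exp(t Q) is exp(- v^T A v / 2) up to a constant.  For t near
    0 the matrix A is still positive definite, so this is a constant multiple
    of the normal density of covariance A^-1, and because Sigma A = 1 - t Gamma
    the integral is det(1 - t Gamma)^(-1/2) (gauss_tilt, mgf_log_quad).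

    The constant c is the multiinformation: the mean of Q is the derivative at
    0 of its moment-generating function (mean_of_mgf), namely tr(Gamma) / 2, and
    Gamma has zero diagonal blocks.  This yields the cumulant-generating
    function t I - ln det(1 - t Gamma) / 2 (multiinfoE, cgf_multiinfo_density).

    The cumulants are read off from
    - ln det(1 - t Gamma) = sum_(l >= 1) tr(Gamma^l) t^l / l (logdet_series)
    together with the uniqueness of the coefficients of a convergent power
    series (power_series_eq0).

    The Gaussian facts used here all come from one factorisation: by a Schur
    complement, a normal density is the marginal density of one part of the
    vector times the conditional density of the other (gauss_schur,
    gauss_schur_swap).  Induction on the dimension and Tonelli then give the
    total mass (integral_multinormal_pdf) and the law of any increasing
    selection of coordinates (marginal_multinormal). *)

(** * Neighbourhoods of zero *)

Section near_zero.
Context {R : realType}.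

Lemma near0_lt (e : R) : 0 < e -> \forall t \near (0 : R), `|t| < e.
Proof. exact: (@nbhs0_lt R R^o). Qed.

Lemma near0_ball (Q : R -> Prop) : (\forall t \near (0 : R), Q t) ->
  exists2 d : R, 0 < d & forall t, `|t| < d -> Q t.
Proof. by have [+ _] := @nbhs_norm0P R R^o Q; apply. Qed.

End near_zero.

(** * Positive definite matrices and Gaussian densities *)

Section posdef.
Context {R : realType}.

Definition qform {n} (S : 'M[R]_n) (v : 'cV[R]_n) : R := (v^T *m S *m v) 0 0.

Lemma qformD n (S1 S2 : 'M[R]_n) v :
  qform (S1 + S2) v = qform S1 v + qform S2 v.
Proof. by rewrite /qform mulmxDr mulmxDl mxE. Qed.

Lemma qformZ n a (S : 'M[R]_n) v : qform (a *: S) v = a * qform S v.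
Proof. by rewrite /qform -scalemxAr -scalemxAl mxE. Qed.

Lemma qformB n (S1 S2 : 'M[R]_n) v :
  qform (S1 - S2) v = qform S1 v - qform S2 v.
Proof. by rewrite /qform mulmxBr mulmxBl mxE [X in _ + X]mxE. Qed.

Lemma posdefmx_unit n (S : 'M[R]_n) : posdefmx S -> S \in unitmx.
Proof.
move=> [_ S0]; rewrite unitmxE unitfE; apply/negP => /det0P[v v0 vS].
have := S0 v^T; rewrite trmxK vS mul0mx mxE ltxx => /(_ _)/notF; apply.
by apply: contra v0 => /eqP v0; rewrite -(trmxK v) v0 trmx0.
Qed.

(** The left inverse L makes K injective, so that K v is nonzero when v is.
    Inverses, principal submatrices and Schur complements are all congruences
    of this form. *)
Lemma posdefmx_congr m n (S : 'M[R]_n) (K : 'M[R]_(n, m)) (L : 'M[R]_(m, n)) :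
  L *m K = 1%:M -> posdefmx S -> posdefmx (K^T *m S *m K).
Proof.
move=> LK [St S0]; split; first by rewrite !trmx_mul trmxK St mulmxA.
move=> v v0; have := S0 (K *m v); rewrite trmx_mul !mulmxA; apply.
apply: contra v0 => /eqP Kv0.
by rewrite -[v]mul1mx -LK -mulmxA Kv0 mulmx0.
Qed.

Lemma posdefmx_inv n (S : 'M[R]_n) : posdefmx S -> posdefmx (invmx S).
Proof.
move=> pS; have uS := posdefmx_unit _ _ pS.
have -> : invmx S = (invmx S)^T *m S *m invmx S.
  by rewrite trmx_inv pS.1 mulVmx// mul1mx.
exact: (posdefmx_congr _ _ _ _ S (mulmxV uS)).
Qed.

Lemma posdefmx_sub m n (f : 'I_m -> 'I_n) (S : 'M[R]_n) :
  injective f -> posdefmx S -> posdefmx (mxsub f f S).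
Proof.
move=> fI pS; have -> : mxsub f f S =
    (colsub f 1%:M)^T *m S *m (colsub f 1%:M).
  have -> : (colsub f 1%:M)^T = rowsub f 1%:M :> 'M[R]_(m, n).
    by apply/matrixP => i j; rewrite !mxE eq_sym.
  rewrite mulmx_colsub mulmx1 mul_rowsub_mx mul1mx.
  by apply/matrixP => i j; rewrite !mxE.
apply: (posdefmx_congr _ _ _ _ (rowsub f 1%:M)) => //.
rewrite mul_rowsub_mx mul1mx; apply/matrixP => i j.
by rewrite !mxE (inj_eq fI).
Qed.

Section block.
Context {m n : nat} (A : 'M[R]_m) (B : 'M[R]_(n, m)) (C : 'M[R]_n).
Hypothesis pS : posdefmx (block_mx A B^T B C).

(** The double transposition keeps the shape [block_mx A B^T B C], so that the
    lemmas on the pivot A apply to the pivot C as well. *)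
Lemma posdefmx_swap : posdefmx (block_mx C B^T^T B^T A).
Proof.
rewrite trmxK.
have := posdefmx_congr _ _ _
  (block_mx 0 1%:M 1%:M 0) (block_mx 0 1%:M 1%:M 0) _ pS.
rewrite tr_block_mx !mulmx_block.
rewrite !(trmx0, trmx1, mul0mx, mulmx0, mul1mx, mulmx1, addr0, add0r); apply.
by rewrite -scalar_mx_block.
Qed.

Lemma posdefmx_ul : posdefmx A.
Proof.
have := posdefmx_congr _ _ _ (col_mx 1%:M 0) (row_mx 1%:M 0) _ pS.
rewrite tr_col_mx mul_row_block !mul_row_col.
by rewrite !(trmx0, trmx1, mul0mx, mulmx0, mul1mx, mulmx1, addr0); apply.
Qed.

(** The Schur complement is the form restricted to the vectors
    (- A^-1 B^T v, v), the minimisers of the form for a given second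
    component. *)
Lemma posdefmx_schur : posdefmx (C - B *m invmx A *m B^T).
Proof.
have uA := posdefmx_unit _ _ posdefmx_ul; have [At _] := posdefmx_ul.
have := posdefmx_congr _ _ _
  (col_mx (- (invmx A *m B^T)) 1%:M) (row_mx 0 1%:M) _ pS.
rewrite tr_col_mx [(- _)^T]linearN/= mul_row_block !mul_row_col trmx_mul.
rewrite trmxK trmx_inv At mul0mx add0r !mulNmx mulmxKV// !trmx1 !mul1mx.
rewrite addNr mul0mx add0r mulmx1.
by rewrite addrC; apply.
Qed.

End block.

Lemma det_schur m n (A : 'M[R]_m) (U : 'M[R]_(m, n)) (B : 'M[R]_(n, m))
    (C : 'M[R]_n) : A \in unitmx ->
  \det (block_mx A U B C) = \det A * \det (C - B *m invmx A *m U).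
Proof.
move=> uA.
have -> : block_mx A U B C = block_mx A 0 B (C - B *m invmx A *m U) *m
    block_mx 1%:M (invmx A *m U) 0 1%:M.
  rewrite mulmx_block !mulmx1 !mulmx0 !addr0 mulmxA mulmxV// mul1mx.
  by rewrite mulmxA addrC subrK.
by rewrite det_mulmx det_lblock det_ublock !det1 !mulr1.
Qed.

Lemma det_schur_swap m n (A : 'M[R]_m) (U : 'M[R]_(m, n)) (B : 'M[R]_(n, m))
    (C : 'M[R]_n) : C \in unitmx ->
  \det (block_mx A U B C) = \det C * \det (A - U *m invmx C *m B).
Proof.
move=> uC.
have -> : block_mx A U B C = block_mx (A - U *m invmx C *m B) U 0 C *m
    block_mx 1%:M 0 (invmx C *m B) 1%:M.
  rewrite mulmx_block !mulmx1 !mulmx0 !add0r mulmxA subrK.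
  by rewrite mulmxA mulmxV// mul1mx.
by rewrite det_mulmx det_lblock det_ublock !det1 !mulr1 mulrC.
Qed.

Lemma sym_block_mxE m n (S : 'M[R]_(m + n)) : S^T = S ->
  S = block_mx (ulsubmx S) (dlsubmx S)^T (dlsubmx S) (drsubmx S).
Proof. by move=> St; rewrite trmx_dlsub St submxK. Qed.

Lemma posdefmx_det_gt0 n (S : 'M[R]_n) : posdefmx S -> 0 < \det S.
Proof.
elim: n S => [|n IH] S; first by rewrite det_mx00.
suff H (M : 'M[R]_(1 + n)) : posdefmx M -> 0 < \det M by exact: H.
move=> pM; move: (pM); rewrite (sym_block_mxE _ _ _ pM.1) => {}pM.
have pA := posdefmx_ul _ _ _ pM.
rewrite (det_schur _ _ _ _ _ _ (posdefmx_unit _ _ pA)) mulr_gt0//.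
  have := pA.2 1%:M; rewrite trmx1 mul1mx mulmx1 det_mx11; apply.
  by apply/eqP => /matrixP/(_ 0 0)/eqP; rewrite !mxE oner_eq0.
by apply: IH; exact: posdefmx_schur.
Qed.

(** Completing the square.  Eliminating w1 from the linear system leaves
    (C - B A^-1 B^T) w2 = v - B A^-1 u, and w1^T u + w2^T v is the value at
    (u, v) of the inverse form.  Working with the solution (w1, w2) avoids any
    formula for the inverse of a block matrix. *)
Lemma qform_pivot m n (A : 'M[R]_m) (B : 'M[R]_(n, m)) (C : 'M[R]_n) u v w1 w2 :
  A^T = A -> C^T = C -> A \in unitmx -> C - B *m invmx A *m B^T \in unitmx ->
  A *m w1 + B^T *m w2 = u -> B *m w1 + C *m w2 = v ->
  (w1^T *m u + w2^T *m v) 0 0 = qform (invmx A) u +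
    qform (invmx (C - B *m invmx A *m B^T)) (v - B *m invmx A *m u).
Proof.
move=> At Ct uA uS <- <-; set S' := C - _.
have St : S'^T = S'.
  by rewrite linearB/= !trmx_mul trmxK trmx_inv At Ct mulmxA.
have e : B *m w1 + C *m w2 - B *m invmx A *m (A *m w1 + B^T *m w2) = S' *m w2.
  rewrite mulmxDr !mulmxA mulmxKV// opprD addrACA subrr add0r.
  by rewrite mulmxBl.
rewrite /qform e trmx_mul St mulmxK//.
rewrite -e; set z := A *m w1 + _; set y := B *m w1 + _.
have -> : z^T = w1^T *m A + w2^T *m B.
  by rewrite [LHS]linearD/= !trmx_mul trmxK At.
rewrite mulmxBr !mulmxDl mulmxK// !mulmxA !mxE; ring.
Qed.

Section qform_block.
Context {m n : nat} (A : 'M[R]_m) (B : 'M[R]_(n, m)) (C : 'M[R]_n).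
Hypothesis pS : posdefmx (block_mx A B^T B C).

Lemma qform_invmx_block u v : exists w1 w2,
  [/\ A *m w1 + B^T *m w2 = u, B *m w1 + C *m w2 = v &
   qform (invmx (block_mx A B^T B C)) (col_mx u v) =
     (w1^T *m u + w2^T *m v) 0 0].
Proof.
set S := block_mx _ _ _ _; have uS : S \in unitmx := posdefmx_unit _ _ pS.
pose w := invmx S *m col_mx u v; exists (usubmx w), (dsubmx w).
have Sw : S *m w = col_mx u v by rewrite mulKVmx.
have [e1 e2] : A *m usubmx w + B^T *m dsubmx w = u /\
    B *m usubmx w + C *m dsubmx w = v.
  by apply: eq_col_mx; rewrite -mul_block_col vsubmxK.
split => //.
rewrite /qform -mul_row_col -tr_col_mx vsubmxK trmx_mul trmx_inv.
by rewrite (_ : S^T = S) //; exact: pS.1.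
Qed.

Lemma qform_schur u v :
  qform (invmx (block_mx A B^T B C)) (col_mx u v) = qform (invmx A) u +
    qform (invmx (C - B *m invmx A *m B^T)) (v - B *m invmx A *m u).
Proof.
have [w1 [w2 [e1 e2 ->]]] := qform_invmx_block u v.
apply: qform_pivot => //.
- exact: (posdefmx_ul _ _ _ pS).1.
- exact: (posdefmx_ul _ _ _ (posdefmx_swap _ _ _ pS)).1.
- exact: posdefmx_unit (posdefmx_ul _ _ _ pS).
- exact: posdefmx_unit (posdefmx_schur _ _ _ pS).
Qed.

Lemma qform_schur_swap u v :
  qform (invmx (block_mx A B^T B C)) (col_mx u v) = qform (invmx C) v +
    qform (invmx (A - B^T *m invmx C *m B)) (u - B^T *m invmx C *m v).
Proof.
have [w1 [w2 [e1 e2 ->]]] := qform_invmx_block u v.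
have pS' := posdefmx_swap _ _ _ pS.
have pC := posdefmx_ul _ _ _ pS'.
have uS' := posdefmx_unit _ _ (posdefmx_schur _ _ _ pS').
have := qform_pivot _ _ C B^T A v u w2 w1 pC.1 (posdefmx_ul _ _ _ pS).1.
move=> /(_ (posdefmx_unit _ _ pC) uS'); rewrite !trmxK.
by rewrite [w1^T *m _ + _]addrC; apply; rewrite addrC.
Qed.

End qform_block.

(** The centred form of [multinormal_pdf], on column vectors: the latter at x
    is by definition [gauss S (col_of_tuple x - mu)]. *)
Definition gauss {n} (S : 'M[R]_n) (v : 'cV[R]_n) : R :=
  expR (- qform (invmx S) v / 2) / Num.sqrt ((2 * pi) ^+ n * \det S).

Lemma gauss_gt0 n (S : 'M[R]_n) v : posdefmx S -> 0 < gauss S v.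
Proof.
move=> pS; rewrite divr_gt0 ?expR_gt0// sqrtr_gt0 mulr_gt0//.
  by rewrite exprn_gt0// mulr_gt0// pi_gt0.
exact: posdefmx_det_gt0.
Qed.

Lemma gaussM m n k (S : 'M[R]_k) (S1 : 'M[R]_m) (S2 : 'M[R]_n) v v1 v2 :
  posdefmx S1 -> posdefmx S2 -> k = (m + n)%N ->
  qform (invmx S) v = qform (invmx S1) v1 + qform (invmx S2) v2 ->
  \det S = \det S1 * \det S2 -> gauss S v = gauss S1 v1 * gauss S2 v2.
Proof.
move=> /posdefmx_det_gt0 d1 /posdefmx_det_gt0 d2 kE eq ed.
have pi2 l : 0 <= ((2 * pi) ^+ l : R) by rewrite exprn_ge0// mulr_ge0 ?pi_ge0.
rewrite /gauss eq ed kE exprD mulrACA sqrtrM ?mulr_ge0 ?(ltW d1)//.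
by rewrite opprD mulrDl expRD invfM mulrACA.
Qed.

Section gauss_block.
Context {m n : nat} (A : 'M[R]_m) (B : 'M[R]_(n, m)) (C : 'M[R]_n).
Hypothesis pS : posdefmx (block_mx A B^T B C).

(** Marginal density of u times conditional density of v given u, whose mean
    B A^-1 u is the regression of v on u and whose covariance is the Schur
    complement. *)
Lemma gauss_schur u v : gauss (block_mx A B^T B C) (col_mx u v) =
  gauss A u * gauss (C - B *m invmx A *m B^T) (v - B *m invmx A *m u).
Proof.
have pA := posdefmx_ul _ _ _ pS.
apply: gaussM => //; first exact: posdefmx_schur.
  exact: qform_schur.
by rewrite det_schur//; exact: posdefmx_unit.
Qed.

Lemma gauss_schur_swap u v : gauss (block_mx A B^T B C) (col_mx u v) =
  gauss C v * gauss (A - B^T *m invmx C *m B) (u - B^T *m invmx C *m v).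
Proof.
have pS' := posdefmx_swap _ _ _ pS.
have pC := posdefmx_ul _ _ _ pS'.
apply: gaussM => //.
- by have := posdefmx_schur _ _ _ pS'; rewrite trmxK.
- exact: addnC.
- exact: qform_schur_swap.
- by rewrite det_schur_swap//; exact: posdefmx_unit.
Qed.

End gauss_block.

Lemma gauss1 (S : 'M[R]_1) (m x : R) : posdefmx S ->
  gauss S (x - m)%:M = normal_pdf m (Num.sqrt (S 0 0)) x.
Proof.
move=> /posdefmx_det_gt0; rewrite det_mx11 => S0.
rewrite normal_pdfE ?gt_eqF ?sqrtr_gt0//.
rewrite /gauss /normal_peak /normal_fun sqr_sqrtr ?ltW// det_mx11 expr1.
rewrite [RHS]mulrC; congr (expR _ / Num.sqrt _); last by rewrite mulr2n; ring.
rewrite [S]mx11_scalar invmx_scalar /qform tr_scalar_mx -!scalar_mxM.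
rewrite !mxE eqxx !mulr1n; field.
by rewrite gt_eqF.
Qed.

End posdef.

(** * Perturbation of positive definite matrices *)

Section posdef_near.
Context {R : realType}.

Lemma qform_ge0 n (S : 'M[R]_n) v : posdefmx S -> 0 <= qform S v.
Proof.
move=> pS; have [->|v0] := eqVneq v 0; last exact/ltW/pS.2.
by rewrite /qform mulmx0 mxE.
Qed.

(** Expand the form at the nonnegative point q x - b y, with q = y^T S y and
    b = x^T S y. *)
Lemma posdefmx_cauchy_schwarz n (S : 'M[R]_n) x y : posdefmx S ->
  ((x^T *m S *m y) 0 0) ^+ 2 <= qform S x * qform S y.
Proof.
move=> pS; have [->|y0] := eqVneq y 0.
  by rewrite /qform !mulmx0 mxE mulr0 expr0n.
set b := (x^T *m S *m y) 0 0; set q := qform S y; set r := qform S x.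
have q0 : 0 < q by exact: pS.2.
have bE : (y^T *m S *m x) 0 0 = b.
  rewrite /b -[x^T *m S *m y]trmxK [in RHS]mxE !trmx_mul trmxK pS.1 mulmxA.
  by [].
have : 0 <= qform S (q *: x - b *: y) by exact: qform_ge0.
rewrite /qform.
have -> : (q *: x - b *: y)^T = q *: x^T - b *: y^T.
  by apply/matrixP => i j; rewrite !mxE.
rewrite mulmxBr !mulmxBl -!scalemxAr -!scalemxAl.
move: q0 bE; rewrite /b /q /r /qform.
move: (x^T *m S *m x) (x^T *m S *m y) (y^T *m S *m x) (y^T *m S *m y).
move=> X1 X2 X3 X4 q0 bE; rewrite !mxE bE.
move: (X1 0 0) (X2 0 0) (X4 0 0) q0 => a b' c c0 H.
by rewrite -subr_ge0 -(pmulr_rge0 _ c0); apply: le_trans H _; nra.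
Qed.

(** Each coordinate v_i = (A^-1 e_i)^T A v is controlled by the form of A
    through Cauchy-Schwarz, and |v_i v_j| by the mean of the two squares. *)
Lemma qform_dominated n (A B : 'M[R]_n) : posdefmx A ->
  exists2 c, 0 <= c & forall v, `|qform B v| <= c * qform A v.
Proof.
move=> pA; have uA := posdefmx_unit _ _ pA.
pose K (i : 'I_n) := qform A (invmx A *m delta_mx i 0).
have K0 i : 0 <= K i by exact: qform_ge0.
have vK (v : 'cV[R]_n) i : (v i 0) ^+ 2 <= K i * qform A v.
  have := posdefmx_cauchy_schwarz _ _ (invmx A *m delta_mx i 0) v pA.
  rewrite trmx_mul trmx_inv pA.1 mulmxKV// trmx_delta -rowE mxE.
  exact: le_trans.
exists (\sum_i \sum_j `|B i j| * (K i + K j)).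
  by do 2 apply: sumr_ge0 => ? _; rewrite mulr_ge0// addr_ge0.
move=> v; rewrite /qform mxE.
under eq_bigr do rewrite mxE mulr_suml.
rewrite exchange_big/= mulr_suml; apply: le_trans (ler_norm_sum _ _ _) _.
apply: ler_sum => i _; rewrite mulr_suml.
apply: le_trans (ler_norm_sum _ _ _) _; apply: ler_sum => j _.
rewrite mxE mulrAC normrM mulrC -mulrA ler_wpM2l//.
have := vK v i; have := vK v j; rewrite mulrDl.
move: (K i * _) (K j * _) => a b.
by rewrite ler_norml; move: (v i 0) (v j 0) => x y; nra.
Qed.

Lemma posdefmx_near n (A B : 'M[R]_n) : posdefmx A -> B^T = B ->
  \forall t \near (0 : R), posdefmx (A + t *: B).
Proof.
move=> pA Bt; have [c c0 cB] := qform_dominated _ _ B pA.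
have c1 : 0 < (c + 1)^-1 by rewrite invr_gt0; lra.
near=> t.
have tc : `|t| * (c + 1) < 1.
  rewrite -ltr_pdivlMr ?mul1r; last by lra.
  by near: t; exact: near0_lt.
split; first by rewrite linearD/= linearZ/= pA.1 Bt.
move=> v v0; rewrite -/(qform _ _) qformD qformZ.
have q0 : 0 < qform A v by exact: pA.2.
have : `|t * qform B v| <= `|t| * (c * qform A v) by rewrite normrM ler_wpM2l.
rewrite ler_norml => /andP[H _].
have : 0 <= `|t| by []. move: q0 tc H; move: `|t| (qform A v) (t * _) => *; nra.
Unshelve. all: by end_near. Qed.

End posdef_near.

(** * The power series of - ln det(1 - tG) *)

Section det_poly.
Context {R : comNzRingType} {n : nat}.

Definition det_poly (G : 'M[R]_n) : {poly R} :=
  \det (1%:M - 'X *: map_mx polyC G).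

Lemma horner_det_poly G t : (det_poly G).[t] = \det (1%:M - t *: G).
Proof.
rewrite -horner_evalE -det_map_mx; congr (\det _).
apply/matrixP => i j; rewrite !mxE /= horner_evalE !hornerE.
by rewrite hornerMn hornerE.
Qed.

Lemma deriv_prod0 (I : Type) (r : seq I) (F : I -> {poly R}) :
  (forall i, (F i).[0] = 1) ->
  (\prod_(i <- r) F i)^`().[0] = \sum_(i <- r) (F i)^`().[0].
Proof.
move=> F0; elim: r => [|i r IH]; first by rewrite !big_nil derivC hornerE.
rewrite !big_cons derivM hornerD !hornerM IH F0 mul1r horner_prod.
by rewrite big1 ?mulr1// => j _; rewrite F0.
Qed.

(** In the Leibniz expansion the identity permutation contributes - tr G; any
    other permutation moves two indices, so that its product is divisible by
    the square of the variable. *)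
Lemma deriv_det_poly0 (G : 'M[R]_n) : (det_poly G)^`().[0] = - \tr G.
Proof.
rewrite /det_poly /determinant linear_sum/= horner_sum (bigD1 (1 : 'S_n)%g)//=.
rewrite odd_perm1 expr0 mul1r [X in _ + X]big1 ?addr0 => [|s s1].
  rewrite deriv_prod0 => [|i]; last first.
    by rewrite perm1 !mxE eqxx mulr1n !hornerE subr0.
  rewrite /mxtrace -sumrN; apply: eq_bigr => i _.
  by rewrite perm1 !mxE eqxx mulr1n !poly.derivE !hornerE.
have [i si] : exists i, s i != i.
  apply/existsP; rewrite -negb_forall; apply: contra s1 => /forallP H.
  by apply/eqP/permP => i; rewrite perm1; exact/eqP.
have ssi : s (s i) != s i by rewrite (inj_eq perm_inj).
rewrite (bigD1 i)//= (bigD1 (s i))//=.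
set A := _ i _; set B := _ (s i) _; set C := \prod_(_ | _) _.
have A0 : A.[0] = 0 by rewrite /A !mxE eq_sym (negbTE si) mulr0n !hornerE oppr0.
have B0 : B.[0] = 0.
  by rewrite /B !mxE eq_sym (negbTE ssi) mulr0n !hornerE oppr0.
rewrite (mulrCA _ A) derivM hornerD !hornerM A0 B0.
by rewrite !(mul0r, mulr0) addr0.
Qed.

End det_poly.

Section logdet.
Context {R : realType} {n : nat}.
Implicit Types G : 'M[R]_n.

Lemma deriv_translate (p q : {poly R}) c t : p \Po ('X + t%:P) = c *: q ->
  p^`().[t] = c * q^`().[0].
Proof.
move=> /(congr1 (fun p => p^`().[0])).
rewrite deriv_comp derivD derivX derivC addr0 mulr1 horner_comp.
by rewrite hornerD hornerX hornerC add0r derivZ hornerZ.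
Qed.

(** Jacobi's formula, reduced to t = 0 by the factorisation
    1 - (t + h) G = (1 - t G)(1 - h Gt) with Gt = (1 - t G)^-1 G. *)
Lemma deriv_det_poly G t : 1%:M - t *: G \in unitmx ->
  (det_poly G)^`().[t] = - \tr (invmx (1%:M - t *: G) *m G) * (det_poly G).[t].
Proof.
move=> u; set Gt := invmx _ *m G.
have : det_poly G \Po ('X + t%:P) = (det_poly G).[t] *: det_poly Gt.
  rewrite horner_det_poly -mul_polyC /det_poly -(det_map_mx polyC) -det_mulmx.
  rewrite -(det_map_mx (comp_poly ('X + t%:P))); congr (\det _).
  rewrite map_mxB map_scalar_mx/= rmorph1 map_mxZ/= comp_polyX.
  have -> : map_mx (comp_poly ('X + t%:P)) (map_mx polyC G) = map_mx polyC G.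
    by apply/matrixP => i j; rewrite !mxE comp_polyC.
  rewrite mulmxBr mulmx1 -scalemxAr -map_mxM mulKVmx//.
  rewrite map_mxB map_mxZ/= map_scalar_mx rmorph1 scalerDl opprD addrA.
  by rewrite addrAC.
by move=> /deriv_translate ->; rewrite deriv_det_poly0 mulrC.
Qed.

Lemma det_near_gt0 G : \forall t \near (0 : R), 0 < \det (1%:M - t *: G).
Proof.
have det0 : 0 < (det_poly G).[0].
  by rewrite horner_det_poly scale0r subr0 det1.
have H : \forall t \near (0 : R), 0 < (det_poly G).[t].
  exact: (@cvgr_gt _ _ _ _ _ _ (@continuous_horner _ (det_poly G) 0) _ det0).
by apply: filterS H => t; rewrite horner_det_poly.
Qed.

Lemma is_derive_logdet G t : 0 < \det (1%:M - t *: G) ->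
  is_derive t (1 : R) (fun t => ln (\det (1%:M - t *: G)))
    (- \tr (invmx (1%:M - t *: G) *m G)).
Proof.
move=> p0; have u : 1%:M - t *: G \in unitmx by rewrite unitmxE unitfE gt_eqF.
have -> : (fun t => ln (\det (1%:M - t *: G))) = @ln R \o horner (det_poly G).
  by apply/funext => x; rewrite /= horner_det_poly.
rewrite -horner_det_poly in p0.
have -> : - \tr (invmx (1%:M - t *: G) *m G) =
    (det_poly G).[t]^-1 * (det_poly G)^`().[t].
  by rewrite deriv_det_poly// mulrCA mulVf ?mulr1// gt_eqF.
by apply: is_derive1_comp; exact: is_derive1_ln.
Qed.

Lemma is_derive_logdet_mgf G t : 0 < \det (1%:M - t *: G) ->
  is_derive t (1 : R) (fun t => expR (2^-1 * - ln (\det (1%:M - t *: G))))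
    (expR (2^-1 * - ln (\det (1%:M - t *: G))) *
      (2^-1 * \tr (invmx (1%:M - t *: G) *m G))).
Proof.
move=> /is_derive_logdet H.
have H2 : is_derive t (1 : R) (2^-1 *: - (fun t => ln (\det (1%:M - t *: G))))
    (2^-1 * \tr (invmx (1%:M - t *: G) *m G)).
  rewrite -[X in 2^-1 * X]opprK; exact: is_deriveZ.
exact: (@is_derive1_comp R expR _ t _ _ (is_derive_expR _) H2).
Qed.

(** Any submultiplicative norm would do for the convergence estimates; this one
    bounds the trace at once. *)
Definition sumnorm {p q} (M : 'M[R]_(p, q)) : R := \sum_i \sum_j `|M i j|.

Lemma sumnorm_ge0 p q (M : 'M[R]_(p, q)) : 0 <= sumnorm M.
Proof. by do 2 apply: sumr_ge0 => ? _. Qed.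

Lemma sumnormD p q (M N : 'M[R]_(p, q)) :
  sumnorm (M + N) <= sumnorm M + sumnorm N.
Proof.
rewrite /sumnorm -big_split ler_sum// => i _.
rewrite -big_split ler_sum// => j _.
by rewrite mxE ler_normD.
Qed.

Lemma sumnormZ p q a (M : 'M[R]_(p, q)) : sumnorm (a *: M) = `|a| * sumnorm M.
Proof.
rewrite /sumnorm mulr_sumr; apply: eq_bigr => i _; rewrite mulr_sumr.
by apply: eq_bigr => j _; rewrite mxE normrM.
Qed.

Lemma sumnormM p q r (M : 'M[R]_(p, q)) (N : 'M[R]_(q, r)) :
  sumnorm (M *m N) <= sumnorm M * sumnorm N.
Proof.
rewrite /sumnorm mulr_suml ler_sum// => i _.
apply: (@le_trans _ _ (\sum_k \sum_j `|M i j| * `|N j k|)).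
  apply: ler_sum => k _; rewrite mxE; apply: le_trans (ler_norm_sum _ _ _) _.
  by apply: ler_sum => j _; rewrite normrM.
rewrite exchange_big/= mulr_suml ler_sum// => j _.
rewrite -mulr_sumr ler_wpM2l//.
rewrite [leRHS](bigD1 j)//= lerDl sumr_ge0// => ? _; exact: sumr_ge0.
Qed.

Lemma mxtrace_le_sumnorm (M : 'M[R]_n) : `|\tr M| <= sumnorm M.
Proof.
apply: le_trans (ler_norm_sum _ _ _) _; apply: ler_sum => i _.
by rewrite (bigD1 i)//= lerDl sumr_ge0.
Qed.

Lemma sumnormX G m (M : 'M[R]_n) :
  sumnorm (G ^+ m *m M) <= sumnorm G ^+ m * sumnorm M.
Proof.
elim: m => [|m IH]; first by rewrite !expr0 mul1mx mul1r.
rewrite !exprS -mulmxA -mulrA; apply: le_trans (sumnormM _ _ _ _ _) _.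
by rewrite ler_wpM2l// sumnorm_ge0.
Qed.

Definition trace_sum G m (t : R) : R :=
  \sum_(1 <= l < m) \tr (G ^+ l) / l%:R * t ^+ l.

Lemma resolventE G t : 1%:M - t *: G \in unitmx ->
  let H := invmx (1%:M - t *: G) *m G in H = G + t *: (G *m H).
Proof.
move=> u H; have : (1%:M - t *: G) *m H = G by rewrite mulKVmx.
by rewrite mulmxBl mul1mx -scalemxAl => /eqP; rewrite subr_eq => /eqP.
Qed.

(** Iterating (1 - t G)^-1 G = G + t G (1 - t G)^-1 G gives the geometric
    series with its exact remainder. *)
Lemma trace_resolvent G t m : 1%:M - t *: G \in unitmx ->
  \tr (invmx (1%:M - t *: G) *m G) =
  \sum_(0 <= l < m) \tr (G ^+ l.+1) * t ^+ l +
    t ^+ m * \tr (G ^+ m *m (invmx (1%:M - t *: G) *m G)).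
Proof.
move=> u; set H := invmx _ *m G.
have eH : H = G + t *: (G *m H) := resolventE _ _ u.
elim: m => [|m IH]; first by rewrite big_nil add0r expr0 mul1r expr0 mul1mx.
rewrite IH big_nat_recr//= -addrA; congr (_ + _).
rewrite {1}eH mulmxDr mxtraceD -scalemxAr mxtraceZ.
have e : G ^+ m *m G = G ^+ m.+1 by rewrite exprSr.
by rewrite mulmxA e [t ^+ m.+1]exprSr; ring.
Qed.

Lemma is_derive_trace_sum G m t :
  is_derive t (1 : R) (trace_sum G m.+1)
    (\sum_(0 <= l < m) \tr (G ^+ l.+1) * t ^+ l).
Proof.
pose p := \sum_(1 <= l < m.+1) (\tr (G ^+ l) / l%:R) *: 'X^l : {poly R}.
have -> : trace_sum G m.+1 = horner p.
  apply/funext => x; rewrite /p horner_sum; apply: eq_bigr => l _.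
  by rewrite !hornerE.
apply: is_derive_eq; rewrite /p linear_sum/= horner_sum big_add1/=.
apply: eq_bigr => l _; rewrite derivZ derivXn hornerZ hornerMn hornerXn/=.
by rewrite -[t ^+ l *+ _]mulr_natl mulrA divfK// pnatr_eq0.
Qed.

Lemma mean_value_bound (f df : R -> R) K t :
  (forall x, `|x| <= `|t| -> is_derive x (1 : R) f (df x)) ->
  (forall x, `|x| <= `|t| -> `|df x| <= K) -> `|f t - f 0| <= K * `|t|.
Proof.
move=> fd dK.
have ab (a b x : R) : `|a| <= `|t| -> `|b| <= `|t| -> x \in `[a, b] ->
    `|x| <= `|t|.
  by rewrite in_itv/= !ler_norml => /andP[? ?] /andP[? ?] /andP[? ?]; lra.
have mvt a b : a <= b -> `|a| <= `|t| -> `|b| <= `|t| ->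
    `|f b - f a| <= K * `|b - a|.
  move=> leab a1 b1.
  have fd' x : x \in `[a, b] -> is_derive x (1 : R) f (df x).
    by move=> xab; apply: fd; exact: ab xab.
  have fc : {within `[a, b], continuous f}.
    apply: derivable_within_continuous => x xab.
    by have [] := fd' _ xab.
  have fo x : x \in `]a, b[ -> is_derive x (1 : R) f (df x).
    by move=> xab; apply: fd'; exact: subset_itv_oo_cc.
  have [c cab ->] := MVT_segment leab fo fc.
  by rewrite normrM ler_wpM2r// dK//; exact: ab cab.
have [t0|/ltW t0] := leP 0 t.
  by have := mvt 0 t t0; rewrite normr0 subr0; apply.
have := mvt t 0 t0; rewrite normr0 sub0r normrN distrC; exact.
Qed.

(** The sum of L(t) = ln det(1 - t G) and the m-th partial sum vanishes at 0,
    and its derivative is, up to sign, the remainder of the trace of the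
    resolvent, at most 2 c (|t| c)^m with c the norm of G.  On |t| c <= 1/2 the mean value theorem
    bounds this sum by a geometric sequence. *)
Theorem logdet_series G : \forall t \near (0 : R),
  trace_sum G ^~ t @ \oo --> - ln (\det (1%:M - t *: G)).
Proof.
pose c := sumnorm G; pose L t := ln (\det (1%:M - t *: G)).
have c0 : 0 <= c by exact: sumnorm_ge0.
have L0 : L 0 = 0 by rewrite /L scale0r subr0 det1 ln1.
have [d d0 dP] : exists2 d : R, 0 < d & forall t, `|t| < d ->
    0 < \det (1%:M - t *: G) /\ `|t| * c <= 2^-1.
  apply: near0_ball; near=> t; split; first by near: t; exact: det_near_gt0.
  have tc : `|t| * (c + 1) < 2^-1.
    rewrite -ltr_pdivlMr; last by lra.
    by near: t; apply: near0_lt; rewrite divr_gt0//; lra.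
  by have := normr_ge0 t; lra.
have bound t m : `|t| < d ->
    `|L t + trace_sum G m.+1 t| <= 2 * c * (2^-1) ^+ m * `|t|.
  move=> td.
  have -> : L t + trace_sum G m.+1 t =
      (L + trace_sum G m.+1) t - (L + trace_sum G m.+1) 0.
    rewrite !fctE /= L0 add0r [X in _ - X]big_nat big1 ?subr0// => l.
    by move=> /andP[l0 _]; rewrite expr0n gtn_eqF// mulr0.
  apply: mean_value_bound => [x xt|x xt].
    apply: is_deriveD; last exact: is_derive_trace_sum.
    by apply: is_derive_logdet; have [] := dP _ (le_lt_trans xt td).
  have [p0 xc] := dP _ (le_lt_trans xt td).
  have u : 1%:M - x *: G \in unitmx by rewrite unitmxE unitfE gt_eqF.
  rewrite (trace_resolvent _ _ m u) opprD addrAC addNr add0r normrN.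
  set H := invmx _ *m G.
  have H2 : sumnorm H <= 2 * c.
    have : sumnorm H <= c + `|x| * (c * sumnorm H).
      rewrite {1}[H](resolventE _ _ u); apply: le_trans (sumnormD _ _ _ _) _.
      by rewrite lerD2l sumnormZ ler_wpM2l// sumnormM.
    have := sumnorm_ge0 _ _ H; move: (sumnorm H) => h h0; rewrite mulrA; nra.
  rewrite normrM normrX.
  apply: (@le_trans _ _ (`|x| ^+ m * (c ^+ m * sumnorm H))).
    rewrite ler_wpM2l ?exprn_ge0//; apply: le_trans (mxtrace_le_sumnorm _) _.
    exact: sumnormX.
  rewrite mulrA -exprMn mulrC ler_pM// ?sumnorm_ge0// ?exprn_ge0 ?mulr_ge0//.
  by rewrite lerXn2r// ?nnegrE ?mulr_ge0 ?invr_ge0.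
near=> t.
have td : `|t| < d by near: t; exact: near0_lt.
suff H : (fun m => trace_sum G m.+1 t) @ \oo --> - L t.
  by rewrite -cvg_shiftS; exact: H.
have -> : (fun m => trace_sum G m.+1 t) =
    (fun m => - L t + (L t + trace_sum G m.+1 t)).
  by apply/funext => m; rewrite addKr.
rewrite -[X in _ --> X]addr0; apply: cvgD; first exact: cvg_cst.
apply/norm_cvg0P.
apply: (@squeeze_cvgr _ _ _ _ (cst 0) (geometric (2 * c * `|t|) 2^-1)).
- near=> m; rewrite /= normr_ge0/= mulrAC; exact: bound.
- exact: cvg_cst.
- by apply: cvg_geometric; rewrite ger0_norm ?invr_ge0// invf_lt1// ltr1n.
Unshelve. all: by end_near. Qed.

End logdet.

(** * Uniqueness of the coefficients of a power series *)

Section power_series.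
Context {R : realType}.

Lemma geometric_tail_le (q : R) m n : 0 <= q -> q <= 2^-1 ->
  \sum_(m <= l < n) q ^+ l <= 2 * q ^+ m.
Proof.
move=> q0 q1; have [mn|nm] := leqP m n; last first.
  by rewrite big_geq ?(ltnW nm)// mulr_ge0// exprn_ge0.
suff : \sum_(m <= l < n) q ^+ l + 2 * q ^+ n <= 2 * q ^+ m.
  by apply: le_trans; rewrite lerDl mulr_ge0// exprn_ge0.
rewrite -(subnK mn); elim: (n - m)%N => [|k IH].
  by rewrite add0n big_geq// add0r.
rewrite addSn big_nat_recr ?leq_addl//=; apply: le_trans IH.
rewrite -addrA lerD2l exprS; have := exprn_ge0 (k + m) q0; nra.
Qed.

(** If m is the first index with a_m nonzero, then the sum of the series at t
    is a_m t^m up to K t^(m + 1), so that |a_m| <= K t for all small t > 0. *)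
Lemma power_series_eq0 (a : nat -> R) :
  (\forall t \near (0 : R),
    (fun n => \sum_(1 <= l < n) a l * t ^+ l) @ \oo --> (0 : R)) ->
  forall l, (0 < l)%N -> a l = 0.
Proof.
move=> /near0_ball[d d0 ad] m; elim/ltn_ind: m => m IH m0.
pose r := d / 2; have r0 : 0 < r by rewrite divr_gt0.
have [M M0 aM] : exists2 M, 0 <= M &
    forall l, (0 < l)%N -> `|a l| * r ^+ l <= M.
  have rd : `|r| < d by rewrite gtr0_norm// /r; lra.
  have := cvg_seq_bounded (cvgP _ (ad _ rd)).
  move=> [M [_ HM]]; exists (2 * (`|M| + 1)) => [|l l0].
    by rewrite mulr_ge0// addr_ge0.
  have M1 : M < `|M| + 1 by rewrite ltr_pwDr// ler_norm.
  have := HM _ M1 l.+1 I; have := HM _ M1 l I.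
  rewrite /= big_nat_recr//= => h1 h2.
  rewrite -(ger0_norm (ltW r0)) -normrX -normrM.
  rewrite -[X in `|X|](addKr (\sum_(1 <= i < l) a i * r ^+ i)).
  apply: le_trans (ler_normD _ _) _; rewrite normrN; lra.
pose K := 2 * M / r ^+ m.+1.
have K0 : 0 <= K by rewrite divr_ge0// ?mulr_ge0// exprn_ge0// ltW.
have bnd t : 0 < t -> t <= r / 2 -> `|a m| <= K * t.
  move=> t0 tr; pose q := t / r.
  have qE l : q ^+ l = t ^+ l / r ^+ l by rewrite /q exprMn exprVn.
  have q0 : 0 <= q by rewrite divr_ge0// ltW.
  have q1 : q <= 2^-1 by rewrite ler_pdivrMr// mulrC.
  have td : `|t| < d by rewrite gtr0_norm// /r; move: tr; rewrite /r; lra.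
  have tn n : (m < n)%N ->
      `|a m * t ^+ m - \sum_(1 <= l < n) a l * t ^+ l| <= K * t ^+ m.+1.
    move=> mn; rewrite (@big_cat_nat _ _ _ m)//= ?(ltnW mn)//.
    have -> : \sum_(1 <= i < m) a i * t ^+ i = 0.
      by rewrite big_nat big1// => l /andP[l0 lm]; rewrite IH// mul0r.
    rewrite add0r big_ltn// opprD addNKr normrN.
    apply: le_trans (ler_norm_sum _ _ _) _.
    apply: (@le_trans _ _ (\sum_(m.+1 <= l < n) M * q ^+ l)).
      rewrite big_nat [leRHS]big_nat; apply: ler_sum => l /andP[ml _].
      rewrite normrM normrX (gtr0_norm t0) qE mulrCA mulrC.
      rewrite ler_wpM2l ?exprn_ge0 ?(ltW t0)//.
      by rewrite ler_pdivlMr ?exprn_gt0// aM// (leq_trans _ ml).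
    rewrite -mulr_sumr.
    apply: le_trans (ler_wpM2l M0 (geometric_tail_le _ m.+1 n q0 q1)) _.
    by rewrite qE /K mulrA [M * 2]mulrC mulrA mulrAC.
  have : `|a m * t ^+ m - 0| <= K * t ^+ m.+1.
    apply: (@cvgr_to_le _ \oo _ _
      (fun n => `|a m * t ^+ m - \sum_(1 <= l < n) a l * t ^+ l|)).
      by apply: cvg_norm; apply: cvgB; [exact: cvg_cst|exact: ad].
    by near=> n; apply: tn; near: n; exact: nbhs_infty_gt.
  rewrite subr0 normrM normrX (gtr0_norm t0) exprS mulrA ler_pM2r//.
  exact: exprn_gt0.
apply/eqP; rewrite -normr_le0 leNgt; apply/negP => am0.
have den0 : 0 < `|a m| + K * r by rewrite ltr_wpDr// mulr_ge0// ltW.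
(* At t = r s / 2 the bound |a_m| <= K t fails, since K r s < |a_m|. *)
pose s := `|a m| / (`|a m| + K * r).
have s0 : 0 < s by rewrite divr_gt0.
have s1 : s <= 1 by rewrite ler_pdivrMr// mul1r lerDl mulr_ge0// ltW.
have sE : s * (`|a m| + K * r) = `|a m| by rewrite divfK// gt_eqF.
have rs : 0 < r * s by rewrite mulr_gt0.
have := bnd (r * s / 2); rewrite divr_gt0// => /(_ isT).
have -> : r * s / 2 <= r / 2 by rewrite ler_pM2r// ler_piMr// ltW.
by move=> /(_ isT); have : 0 < s * `|a m| by [exact: mulr_gt0]; nra.
Unshelve. all: by end_near. Qed.

End power_series.

(** * Normal densities on tuples *)

Section integral_tuple.
Context {R : realType}.
Local Open Scope ereal_scope.

Section cons.
Variables (n : nat) (h : n.+1.-tuple R -> \bar R).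
Hypotheses (mh : measurable_fun setT h) (h0 : forall x, 0 <= h x).

Let mh' : measurable_fun setT (h \o @tcons R n).
Proof. by apply: measurableT_comp => //; exact: measurable_tcons. Qed.

Let pushE : \int[lebesgue_tuple n.+1]_x h x =
  \int[lebesgue_measure \x lebesgue_tuple n]_z h (tcons z).
Proof.
have H := @ge0_integral_pushforward _ _ _ _ _ _ (@measurable_tcons R n)
  (lebesgue_measure \x lebesgue_tuple n) setT h measurableT mh
  (fun y _ => h0 y).
exact: H.
Qed.

Lemma integral_tuple_cons : \int[lebesgue_tuple n.+1]_x h x =
  \int[lebesgue_measure]_x \int[lebesgue_tuple n]_y h (tcons (x, y)).
Proof. by rewrite pushE fubini_tonelli1. Qed.

Lemma integral_tuple_cons_swap : \int[lebesgue_tuple n.+1]_x h x =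
  \int[lebesgue_tuple n]_y \int[lebesgue_measure]_x h (tcons (x, y)).
Proof. by rewrite pushE fubini_tonelli2. Qed.

End cons.

Lemma integral_tuple0 (h : 0.-tuple R -> \bar R) :
  measurable_fun setT h -> \int[lebesgue_tuple 0]_x h x = h [tuple].
Proof.
move=> mh; rewrite /= integral_dirac//.
by rewrite diracT mul1e.
Qed.

End integral_tuple.

Section multinormal_pdf.
Context {R : realType}.

Lemma measurable_qform n mu (M : 'M[R]_n) :
  measurable_fun setT (fun x : n.-tuple R => qform M (col_of_tuple x - mu)).
Proof.
have mv i :
    measurable_fun setT (fun x : n.-tuple R => (col_of_tuple x - mu) i 0).
  have -> : (fun x : n.-tuple R => (col_of_tuple x - mu) i 0) =
      (fun x => tnth x i - mu i 0) by apply/funext => x; rewrite !mxE.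
  by apply: measurable_funB => //; exact: measurable_tnth.
rewrite (_ : (fun x => _) = (fun x : n.-tuple R =>
    \sum_j (\sum_i (col_of_tuple x - mu) i 0 * M i j) *
      (col_of_tuple x - mu) j 0)); last first.
  apply/funext => x; rewrite /qform mxE; apply: eq_bigr => j _; congr (_ * _).
  by rewrite mxE; apply: eq_bigr => i _; rewrite mxE.
apply: measurable_sum => j; apply: measurable_funM => //.
by apply: measurable_sum => i; exact: measurable_funM.
Qed.

Lemma measurable_multinormal_pdf n mu (S : 'M[R]_n) :
  measurable_fun setT (multinormal_pdf mu S).
Proof.
rewrite /multinormal_pdf; apply: measurable_funM => //.
apply: measurableT_comp => //; apply: measurable_funM => //.
by apply: measurableT_comp => //; exact: measurable_qform.
Qed.

Lemma emeasurable_multinormal_pdf n mu (S : 'M[R]_n) :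
  measurable_fun setT (fun x => (multinormal_pdf mu S x)%:E).
Proof. by apply/measurable_EFinP; exact: measurable_multinormal_pdf. Qed.

Lemma multinormal_pdf_gt0 n mu (S : 'M[R]_n) x :
  posdefmx S -> 0 < multinormal_pdf mu S x.
Proof. exact: gauss_gt0. Qed.

Section cons.
Context {n : nat} (A : 'M[R]_1) (B : 'M[R]_(n, 1)) (C : 'M[R]_n).
Hypothesis pS : posdefmx (block_mx A B^T B C).
Variables (m : R) (mu : 'cV[R]_n).

Let colE x y : col_of_tuple (tcons (x, y)) - col_mx m%:M mu =
  col_mx (x - m)%:M (col_of_tuple y - mu).
Proof.
apply/matrixP => i j; rewrite ord1 !mxE; case: (@splitP 1 n i) => k ik.
  rewrite (ord1 k) (_ : i = ord0) ?tnth0 ?mxE ?eqxx//.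
  by apply/val_inj; rewrite /= ik (ord1 k).
rewrite (_ : i = lift ord0 k) ?tnthS ?mxE//.
by apply/val_inj; rewrite /= ik.
Qed.

(** The head of the tuple has a one-dimensional normal density, and the tail
    is conditioned on it. *)
Lemma multinormal_pdf_condition_head x y :
  multinormal_pdf (col_mx m%:M mu) (block_mx A B^T B C) (tcons (x, y)) =
  normal_pdf m (Num.sqrt (A 0 0)) x *
  multinormal_pdf (mu + B *m invmx A *m (x - m)%:M) (C - B *m invmx A *m B^T) y.
Proof.
rewrite -gauss1; last exact: posdefmx_ul pS.
rewrite -[LHS]/(gauss _ (_ - _)) colE (gauss_schur _ _ _ pS).
by rewrite -addrA -opprD.
Qed.

(** The opposite order of conditioning: the head appears only in a
    one-dimensional density, which integrates to 1 whatever the tail is. *)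
Lemma multinormal_pdf_condition_tail x y :
  multinormal_pdf (col_mx m%:M mu) (block_mx A B^T B C) (tcons (x, y)) =
  multinormal_pdf mu C y *
  normal_pdf (m + (B^T *m invmx C *m (col_of_tuple y - mu)) 0 0)
    (Num.sqrt ((A - B^T *m invmx C *m B) 0 0)) x.
Proof.
rewrite -gauss1; last first.
  by have := posdefmx_schur _ _ _ (posdefmx_swap _ _ _ pS); rewrite trmxK.
rewrite -[LHS]/(gauss _ (_ - _)) colE (gauss_schur_swap _ _ _ pS).
congr (_ * gauss _ _); rewrite [in LHS](mx11_scalar (_ *m (_ - _))).
by apply/matrixP => i j; rewrite !ord1 !mxE eqxx !mulr1n opprD addrA.
Qed.

End cons.

Local Open Scope ereal_scope.

Lemma integral_multinormal_pdf n mu (S : 'M[R]_n) : posdefmx S ->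
  \int[lebesgue_tuple n]_x (multinormal_pdf mu S x)%:E = 1.
Proof.
elim: n mu S => [|n IH] mu S pS.
  rewrite integral_tuple0; last exact: emeasurable_multinormal_pdf.
  rewrite /multinormal_pdf (thinmx0 (_^T)) !mul0mx mxE oppr0 mul0r expR0.
  by rewrite det_mx00 expr0 mulr1 sqrtr1 divr1.
suff H : forall (mu : 'cV[R]_(1 + n)) (S : 'M[R]_(1 + n)), posdefmx S ->
  \int[lebesgue_tuple n.+1]_x (multinormal_pdf (mu : 'cV[R]_n.+1) S x)%:E = 1.
  exact: H.
move=> {pS} {}mu {}S pS.
rewrite integral_tuple_cons_swap; last 2 first.
- exact: emeasurable_multinormal_pdf.
- by move=> x; rewrite lee_fin ltW// multinormal_pdf_gt0.
rewrite -(vsubmxK mu) [usubmx mu]mx11_scalar.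
move: (usubmx mu 0%R 0%R) (dsubmx mu) => m mu'.
move: (pS); rewrite (sym_block_mxE _ _ _ pS.1).
move: (ulsubmx S) (dlsubmx S) (drsubmx S) => A B C {}pS.
rewrite -[RHS](IH mu' C); last exact: posdefmx_ul (posdefmx_swap _ _ _ pS).
apply: eq_integral => y _.
under eq_integral do rewrite (multinormal_pdf_condition_tail _ _ _ pS) EFinM.
rewrite ge0_integralZl_EFin//=.
- by rewrite integral_normal_pdf mule1.
- by move=> x _; rewrite lee_fin normal_pdf_ge0.
- by apply/measurable_EFinP; exact: measurable_normal_pdf.
- apply/ltW/multinormal_pdf_gt0; exact: posdefmx_ul (posdefmx_swap _ _ _ pS).
Qed.

End multinormal_pdf.

(** * Marginals of normal densities *)

Section marginal.
Context {R : realType}.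

Definition restrict {n k} (s : 'I_k -> 'I_n) (x : n.-tuple R) : k.-tuple R :=
  [tuple tnth x (s i) | i < k].

Lemma measurable_restrict n k (s : 'I_k -> 'I_n) :
  measurable_fun setT (restrict s).
Proof.
apply/measurable_fun_tnthP => i.
rewrite (_ : _ \o _ = @tnth _ R ^~ (s i)); first exact: measurable_tnth.
by apply/funext => x /=; rewrite tnth_mktuple.
Qed.

Lemma lift0_factor n k (s : 'I_k -> 'I_n.+1) : (forall i, s i != ord0) ->
  exists s' : 'I_k -> 'I_n, forall i, s i = lift ord0 (s' i).
Proof.
move=> s0.
apply: (@fin_all_exists _ (fun _ => 'I_n) (fun i j => s i = lift ord0 j)) => i.
have := s0 i; case: (unliftP ord0 (s i)) => [j ->|->]; last by rewrite eqxx.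
by exists j.
Qed.

Lemma restrict_lift0 n k (s : 'I_k -> 'I_n.+1) s' x (y : n.-tuple R) :
  (forall i, s i = lift ord0 (s' i)) ->
  restrict s (tcons (x, y)) = restrict s' y.
Proof.
by move=> e; apply: eq_from_tnth => i; rewrite !tnth_mktuple e tnthS.
Qed.

Lemma restrict_cons n k (s : 'I_k.+1 -> 'I_n.+1) s' x (y : n.-tuple R) :
  s ord0 = ord0 -> (forall i, s (lift ord0 i) = lift ord0 (s' i)) ->
  restrict s (tcons (x, y)) = tcons (x, restrict s' y).
Proof.
move=> s0 e; apply: eq_from_tnth => i; rewrite tnth_mktuple.
case: (unliftP ord0 i) => [j|] ->; first by rewrite e !tnthS tnth_mktuple.
by rewrite s0 !tnth0.
Qed.

Lemma rshift0 n (i : 'I_n) : lift ord0 i = rshift 1 i.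
Proof. exact: val_inj. Qed.

Section blocks.
Context {n k : nat} (A : 'M[R]_1) (B : 'M[R]_(n, 1)) (C : 'M[R]_n).
Variables (m : 'cV[R]_1) (mu : 'cV[R]_n) (s' : 'I_k -> 'I_n).

Lemma rowsub_lift0 (s : 'I_k -> 'I_n.+1) : (forall i, s i = lift ord0 (s' i)) ->
  rowsub s (col_mx m mu) = rowsub s' mu.
Proof.
move=> e; apply/matrixP => i j.
by rewrite [LHS]mxE e rshift0 [LHS]col_mxEd [RHS]mxE.
Qed.

Lemma mxsub_lift0 (s : 'I_k -> 'I_n.+1) : (forall i, s i = lift ord0 (s' i)) ->
  mxsub s s (block_mx A B^T B C) = mxsub s' s' C.
Proof.
move=> e; apply/matrixP => i j.
by rewrite [LHS]mxE !e !rshift0 [LHS]block_mxEdr [RHS]mxE.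
Qed.

Section keep.
Variable s : 'I_k.+1 -> 'I_n.+1.
Hypothesis s0 : s ord0 = ord0.
Hypothesis e : forall i, s (lift ord0 i) = lift ord0 (s' i).

Let sl (i : 'I_1) : s (lshift k i) = lshift n i.
Proof.
have -> : lshift k i = ord0 by apply: val_inj; rewrite /= (ord1 i).
by rewrite s0; apply: val_inj; rewrite /= (ord1 i).
Qed.

Let sr (i : 'I_k) : s (rshift 1 i) = rshift 1 (s' i).
Proof. by rewrite -!rshift0 e. Qed.

Lemma rowsub_cons :
  rowsub s (col_mx m mu) = col_mx m (rowsub s' mu) :> 'cV_(1 + k).
Proof.
apply/colP => i; case: (@split_ordP 1 k i) => j ->; rewrite mxE.
  by rewrite sl [LHS]col_mxEu [RHS]col_mxEu.
by rewrite sr [LHS]col_mxEd [RHS]col_mxEd [RHS]mxE.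
Qed.

Lemma mxsub_cons : mxsub s s (block_mx A B^T B C) =
  block_mx A (rowsub s' B)^T (rowsub s' B) (mxsub s' s' C) :> 'M[R]_(1 + k).
Proof.
apply/matrixP => i j; rewrite [LHS]mxE.
case: (@split_ordP 1 k i) => i' ->; case: (@split_ordP 1 k j) => j' ->;
  rewrite ?sl ?sr.
- by rewrite [LHS]block_mxEul [RHS]block_mxEul.
- by rewrite [LHS]block_mxEur [RHS]block_mxEur !mxE.
- by rewrite [LHS]block_mxEdl [RHS]block_mxEdl !mxE.
- by rewrite [LHS]block_mxEdr [RHS]block_mxEdr !mxE.
Qed.

End keep.
End blocks.

Local Open Scope ereal_scope.

(** Induction on n.  If s omits the coordinate 0, that coordinate is integrated
    out after conditioning on the tail.  If s selects it, both sides are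
    conditioned on it and the induction hypothesis is applied to the tail, a
    normal density whose mean and covariance restrict along s as they should.
    As s is increasing, a selected coordinate 0 comes first in the selection. *)
Theorem marginal_multinormal n k (s : 'I_k -> 'I_n) mu (S : 'M[R]_n)
    (g : k.-tuple R -> \bar R) :
  (forall i j : 'I_k, (i < j)%N -> (s i < s j)%N) -> posdefmx S ->
  measurable_fun setT g -> (forall z, 0 <= g z) ->
  \int[lebesgue_tuple n]_x ((multinormal_pdf mu S x)%:E * g (restrict s x)) =
  \int[lebesgue_tuple k]_z
    ((multinormal_pdf (rowsub s mu) (mxsub s s S) z)%:E * g z).
Proof.
elim: n k s mu S g => [|n IH] k s mu S g sm pS mg g0.
  case: k s g sm mg g0 => [|k] s g sm mg g0; last by case: (s ord0).
  have mG (h : 0.-tuple R -> \bar R) : measurable_fun setT h.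
    have -> : h = cst (h [tuple]) by apply/funext => x; rewrite (tuple0 x).
    exact: measurable_cst.
  rewrite !integral_tuple0//.
  have -> : rowsub s mu = mu by apply/matrixP => -[].
  have -> : mxsub s s S = S by apply/matrixP => -[].
  by rewrite (tuple0 (restrict _ _)).
suff H (A : 'M[R]_1) (B : 'cV[R]_n) (C : 'M[R]_n) m (nu : 'cV[R]_n) :
    let S1 := block_mx A B^T B C in let mu1 := col_mx m%:M nu in
    posdefmx S1 ->
    \int[lebesgue_tuple n.+1]_x
      ((multinormal_pdf (mu1 : 'cV[R]_n.+1) S1 x)%:E * g (restrict s x)) =
    \int[lebesgue_tuple k]_z
      ((multinormal_pdf (rowsub s mu1) (mxsub s s S1) z)%:E * g z).
  have := H (@ulsubmx _ 1 n 1 n S) (@dlsubmx _ 1 n 1 n S) (@drsubmx _ 1 n 1 n S)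
    (@usubmx _ 1 n 1 mu 0%R 0%R) (@dsubmx _ 1 n 1 mu).
  rewrite /= -mx11_scalar vsubmxK -sym_block_mxE; last exact: pS.1.
  by apply.
move=> S1 mu1 {mu S} {}pS.
have mh : measurable_fun setT (fun x =>
    (multinormal_pdf (mu1 : 'cV[R]_n.+1) S1 x)%:E * g (restrict s x)).
  apply: emeasurable_funM; first exact: emeasurable_multinormal_pdf.
  by apply: measurableT_comp => //; exact: measurable_restrict.
have h0 x :
    0 <= (multinormal_pdf (mu1 : 'cV[R]_n.+1) S1 x)%:E * g (restrict s x).
  by rewrite mule_ge0// lee_fin ltW// multinormal_pdf_gt0.
have mn mm a : measurable_fun [set: measurableTypeR R]
    (fun x => (normal_pdf mm a x)%:E).
  by apply/measurable_EFinP; exact: measurable_normal_pdf.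
have [/forallP s0|] := boolP [forall i, s i != ord0].
  have [s' e] := lift0_factor _ _ _ s0.
  rewrite (rowsub_lift0 _ _ _ _ e) (mxsub_lift0 _ _ _ _ _ e).
  have pC : posdefmx C by exact: posdefmx_ul (posdefmx_swap _ _ _ pS).
  rewrite -IH//; last first.
    by move=> i j /sm; rewrite !e.
  rewrite integral_tuple_cons_swap//; apply: eq_integral => y _.
  under eq_integral do
    rewrite (multinormal_pdf_condition_tail _ _ _ pS)
      (restrict_lift0 _ _ _ _ _ _ e) EFinM muleAC.
  rewrite ge0_integralZl//.
  - by rewrite integral_normal_pdf mule1.
  - by move=> x _; rewrite lee_fin normal_pdf_ge0.
  - by rewrite mule_ge0// lee_fin ltW// multinormal_pdf_gt0.
move=> /forallPn[i0]; rewrite negbK => /eqP si0.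
case: k s g sm mg g0 mh h0 i0 si0 => [|k] s g sm mg g0 mh h0 i0 si0.
  by case: i0 {si0}.
have s0 : s ord0 = ord0.
  have [<-//|] := eqVneq i0 ord0; rewrite -val_eqE -lt0n => i0_gt0.
  by have := sm ord0 i0 i0_gt0; rewrite si0.
have [s' e] : exists s' : 'I_k -> 'I_n,
    forall i, s (lift ord0 i) = lift ord0 (s' i).
  apply: lift0_factor => i; have := sm ord0 (lift ord0 i) isT.
  by rewrite s0; apply: contraTneq => ->.
have mhs : measurable_fun setT (fun z =>
    (multinormal_pdf (rowsub s mu1) (mxsub s s S1) z)%:E * g z).
  by apply: emeasurable_funM => //; exact: emeasurable_multinormal_pdf.
have pSs : posdefmx (mxsub s s S1).
  apply: posdefmx_sub => // i j sij; apply/val_inj/eqP.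
  rewrite eqn_leq leqNgt [X in _ && X]leqNgt; apply/andP.
  by split; apply/negP => /sm; rewrite sij ltnn.
have hs0 z : 0 <= (multinormal_pdf (rowsub s mu1) (mxsub s s S1) z)%:E * g z.
  by rewrite mule_ge0// lee_fin ltW// multinormal_pdf_gt0.
rewrite integral_tuple_cons// integral_tuple_cons//.
rewrite (rowsub_cons _ _ _ _ s0 e) (mxsub_cons _ _ _ _ _ s0 e) in pSs *.
have pC := posdefmx_schur _ _ _ pS.
have mgt x : measurable_fun setT (fun z : k.-tuple R => g (tcons (x, z))).
  apply: (measurableT_comp mg).
  apply: (measurableT_comp (@measurable_tcons R k)).
  exact: pair1_measurable.
apply: eq_integral => x _.
under eq_integral do
  rewrite (multinormal_pdf_condition_head _ _ _ pS)
    (restrict_cons _ _ _ _ _ _ s0 e) EFinM -muleA.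
under [RHS]eq_integral do
  rewrite (multinormal_pdf_condition_head _ _ _ pSs) EFinM -muleA.
have pdfT j (nu' : 'cV[R]_j) (M : 'M[R]_j) (h : j.-tuple R -> \bar R) :
    measurable_fun setT h -> measurable_fun setT
      (fun z => (multinormal_pdf nu' M z)%:E * h z).
  move=> mh'; apply: emeasurable_funM => //.
  exact: emeasurable_multinormal_pdf.
have pdf0 j (nu' : 'cV[R]_j) (M : 'M[R]_j) (h : j.-tuple R -> \bar R) :
    posdefmx M -> (forall z, 0 <= h z) ->
    forall z, 0 <= (multinormal_pdf nu' M z)%:E * h z.
  by move=> pM h'0 z; rewrite mule_ge0// lee_fin ltW// multinormal_pdf_gt0.
have pCs := @posdefmx_schur R 1 k _ _ _ pSs.
rewrite ge0_integralZl//; last 3 first.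
- by apply: pdfT; apply: (measurableT_comp (mgt x)); exact: measurable_restrict.
- move=> z _; exact: (pdf0 _ _ _ (fun z => g (tcons (x, restrict s' z))) pC).
- by rewrite lee_fin normal_pdf_ge0.
rewrite ge0_integralZl//; last 3 first.
- exact: pdfT.
- move=> z _; exact: (pdf0 _ _ _ (fun z => g (tcons (x, z))) pCs).
- by rewrite lee_fin normal_pdf_ge0.
congr (_ * _); rewrite (IH _ s' _ _ (fun z => g (tcons (x, z))))//; last first.
  by move=> i j ij; have := sm (lift ord0 i) (lift ord0 j) ij; rewrite !e.
have -> : rowsub s' (nu + B *m invmx A *m (x - m)%:M)%R =
    (rowsub s' nu + rowsub s' B *m invmx A *m (x - m)%:M)%R.
  by rewrite !mul_rowsub_mx; apply/matrixP => i j; rewrite !mxE.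
have -> : mxsub s' s' (C - B *m invmx A *m B^T)%R =
    (mxsub s' s' C - rowsub s' B *m invmx A *m (rowsub s' B)^T)%R.
  have -> : (rowsub s' B)^T = colsub s' B^T.
    by apply/matrixP => i j; rewrite !mxE.
  by rewrite !mul_rowsub_mx mulmx_colsub; apply/matrixP => i j; rewrite !mxE.
by [].
Qed.

End marginal.

(** * Densities of random vectors *)

Section density.
Context {R : realType} {d : measure_display} {T : measurableType d}.
Context (P : probability T R) {n : nat} (X : {RV P >-> n.-tuple R}).
Local Open Scope ereal_scope.

Lemma density_measurable f : is_density P X f ->
  measurable_fun setT (fun x => (f x)%:E).
Proof. by case=> mf _ _; exact/measurable_EFinP. Qed.

Lemma density_integral1 f : is_density P X f ->
  \int[lebesgue_tuple n]_x (f x)%:E = 1.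
Proof.
case=> _ _ <-//.
by rewrite /distribution /pushforward preimage_setT probability_setT.
Qed.

Lemma density_integrable f : is_density P X f ->
  (lebesgue_tuple n).-integrable setT (fun x => (f x)%:E).
Proof.
move=> df; have [mf f0 _] := df; apply/integrableP.
split; first exact: density_measurable.
under eq_integral do rewrite gee0_abs ?lee_fin//.
by rewrite density_integral1// ltry.
Qed.

Lemma density_ae_eq f g : is_density P X f -> is_density P X g ->
  ae_eq (lebesgue_tuple n) setT f g.
Proof.
move=> df dg.
have : ae_eq (lebesgue_tuple n) setT (fun x => (f x)%:E) (fun x => (g x)%:E).
  apply: integral_ae_eq => //.
  - exact: density_integrable.
  - exact: density_measurable.
  - by move=> E _ mE; have [_ _ <-//] := df; have [_ _ <-] := dg.
by apply: filterS => x /= H _; have [] := H I.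
Qed.

Lemma density_dominates f : is_density P X f ->
  distribution P X `<< lebesgue_tuple n.
Proof.
move=> df; have [mf f0 fA] := df.
apply/null_content_dominatesP => A mA A0.
transitivity (\int[lebesgue_tuple n]_(x in A) (f x)%:E); first exact: fA.
apply: null_set_integral => //; apply: measurable_funTS.
exact: density_measurable.
Qed.

(** The density is a version of the Radon-Nikodym derivative of the law. *)
Lemma expectation_density f (h : n.-tuple R -> \bar R) : is_density P X f ->
  measurable_fun setT h -> (forall x, 0 <= h x) ->
  \int[P]_w h (X w) = \int[lebesgue_tuple n]_x ((f x)%:E * h x).
Proof.
move=> df mh h0; have [mf f0 fA] := df; have dom := density_dominates _ df.
have mX : measurable_fun setT X by [].
have -> : \int[P]_w h (X w) = \int[distribution P X]_x h x.
  by rewrite (ge0_integral_pushforward mX)//.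
pose g := Radon_Nikodym_SigmaFinite.f (distribution P X) (lebesgue_tuple n).
have H := Radon_Nikodym_SigmaFinite.change_of_variables dom h0 measurableT mh.
rewrite -[LHS]H -/g.
have gi : (lebesgue_tuple n).-integrable setT g.
  exact: Radon_Nikodym_SigmaFinite.f_integrable.
have mg : measurable_fun setT g by exact: measurable_int gi.
apply: ge0_ae_eq_integral => //.
- exact: emeasurable_funM.
- by apply: emeasurable_funM => //; exact: density_measurable.
- by move=> x _; rewrite mule_ge0//; exact: Radon_Nikodym_SigmaFinite.f_ge0.
- by move=> x _; rewrite mule_ge0// lee_fin.
have : ae_eq (lebesgue_tuple n) setT g (fun x => (f x)%:E).
  apply: integral_ae_eq => //; first exact: density_measurable.
  move=> E _ mE; rewrite -Radon_Nikodym_SigmaFinite.f_integral//; exact: fA.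
by apply: filterS => x /= e _; rewrite muleC e.
Qed.

End density.

Section marginal_density.
Context {R : realType} {d : measure_display} {T : measurableType d}.
Context (P : probability T R) {N : nat} (p : 'I_N -> nat).
Context (X : {RV P >-> (\sum_(n < N) p n).-tuple R}).

Lemma ltn_Rank (n : 'I_N) (i j : 'I_(p n)) :
  (i < j)%N -> (tagnat.Rank n i < tagnat.Rank n j)%N.
Proof. by rewrite !tagnat.RankEsum ltn_add2l. Qed.

Lemma Rank_injective (n : 'I_N) : injective (@tagnat.Rank N p n).
Proof.
move=> i j /(congr1 (@nat_of_ord _)); rewrite !tagnat.RankEsum => /addnI ij.
exact: val_inj.
Qed.

Lemma marginal_density mu S (n : 'I_N) : posdefmx S -> multinormal P X mu S ->
  is_density P (subvec p n \o X)
    (multinormal_pdf (submxcol mu n) (submxblock S n n)).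
Proof.
move=> pS dX; have pSn : posdefmx (submxblock S n n).
  exact: posdefmx_sub (@Rank_injective n) pS.
split.
- exact: measurable_multinormal_pdf.
- by move=> x; exact/ltW/multinormal_pdf_gt0.
move=> A mA.
have -> : distribution P (subvec p n \o X) A =
    (\int[P]_w (\1_A (subvec p n (X w)))%:E)%E.
  have -> : (\int[P]_w (\1_A (subvec p n (X w)))%:E)%E =
      (\int[P]_w (\1_((subvec p n \o X) @^-1` A) w)%:E)%E.
    by apply: eq_integral => w _; rewrite !indicE.
  rewrite integral_indic// ?setIT//.
  rewrite -[X in measurable X]setTI.
  apply: measurableT_comp => //; exact: measurable_subvec.
have mI : measurable_fun setT (fun x : (p n).-tuple R => (\1_A x : R)%:E).
  by apply/measurable_EFinP; exact: measurable_indic.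
have mR : measurable_fun setT (fun x => (\1_A (subvec p n x) : R)%:E).
  by apply: (measurableT_comp mI); exact: measurable_subvec.
rewrite (expectation_density P X _ (fun x => (\1_A (subvec p n x))%:E) dX)//.
rewrite [LHS](marginal_multinormal _ _ (@tagnat.Rank N p n) mu S
  (fun x => (\1_A x)%:E))//.
- rewrite [RHS]integral_mkcond; apply: eq_integral => x _.
  by rewrite patchE indicE; case: ifP => xA; rewrite ?mule1 ?mule0.
- exact: ltn_Rank.
Qed.

End marginal_density.

(** * The mean as the derivative of the moment-generating function *)

Section mean_of_mgf.
Context {d} {T : measurableType d} {R : realType}.
Variable mu : {measure set T -> \bar R}.
Variables (w q : T -> R) (M dM : R -> R).
Hypotheses (mw : measurable_fun setT w) (w0 : forall x, 0 <= w x).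
Hypothesis mq : measurable_fun setT q.
Hypothesis w1 : (\int[mu]_x (w x)%:E = 1)%E.
Hypothesis Mder : \forall t \near (0 : R), is_derive t (1 : R) M (dM t).
Hypothesis mgf : \forall t \near (0 : R),
  (\int[mu]_x (w x * expR (t * q x))%:E = (M t)%:E)%E.

Let mwe t : measurable_fun setT (fun x => (w x * expR (t * q x))%:E).
Proof.
apply/measurable_EFinP; apply: measurable_funM => //.
by apply: measurableT_comp => //; exact: measurable_funM.
Qed.

Let wei t : (\int[mu]_x (w x * expR (t * q x))%:E = (M t)%:E)%E ->
  mu.-integrable setT (fun x => (w x * expR (t * q x))%:E).
Proof.
move=> e; apply/integrableP; split; first exact: mwe.
under eq_integral do rewrite gee0_abs ?lee_fin ?mulr_ge0 ?expR_ge0//.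
by rewrite e ltry.
Qed.

Let wi : mu.-integrable setT (EFin \o w).
Proof.
apply/integrableP; split; first exact/measurable_EFinP.
under eq_integral do rewrite gee0_abs ?lee_fin//.
by rewrite w1 ltry.
Qed.

(** The inequality |t q| <= exp(t q) + exp(- t q) bounds q by two integrable
    exponentials. *)
Lemma mgf_integrable : mu.-integrable setT (fun x => (w x * q x)%:E).
Proof.
have [e e0 H] := near0_ball _ mgf.
pose t := e / 2; have t0 : 0 < t by rewrite divr_gt0.
have te : `|t| < e by rewrite gtr0_norm// /t; lra.
have i1 := wei _ (H _ te); have i2 : mu.-integrable setT _ := wei (- t) _.
have {}i2 := i2 (H (- t) _); rewrite normrN in i2; have {}i2 := i2 te.
apply: (@le_integrable _ _ _ mu setT measurableT _
  (fun x => t^-1%:E *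
    ((w x * expR (t * q x))%:E + (w x * expR (- t * q x))%:E))%E).
- by apply/measurable_EFinP; exact: measurable_funM.
- move=> x _; rewrite -EFinD -EFinM !abse_EFin lee_fin.
  rewrite [leRHS]ger0_norm; last first.
    by rewrite mulr_ge0 ?invr_ge0 ?(ltW t0)// addr_ge0 ?mulr_ge0 ?expR_ge0.
  rewrite normrM (ger0_norm (w0 x)) -mulrDr mulrCA ler_wpM2l//.
  rewrite ler_pdivlMl//.
  have := expR_ge1Dx (t * q x); have := expR_ge1Dx (- t * q x).
  have := expR_ge0 (t * q x); have := expR_ge0 (- t * q x).
  have [q0|q0] := leP 0 (q x); [rewrite ger0_norm//|rewrite ltr0_norm//]; lra.
- by apply: integrableZl => //; exact: integrableD.
Qed.

(** Integrating 1 + t q <= exp(t q) shows that M(t) - t E, with E the mean of q,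
    is minimal at t = 0; hence its derivative vanishes there. *)
Lemma mean_of_mgf : (\int[mu]_x (w x * q x)%:E = (dM 0)%:E)%E.
Proof.
have iq := mgf_integrable.
pose E := fine (\int[mu]_x (w x * q x)%:E)%E.
have EE : (\int[mu]_x (w x * q x)%:E = E%:E)%E.
  by rewrite /E fineK//; exact: integrable_fin_num.
have [e e0 H] := near0_ball _ (filterI Mder mgf).
have M0 : M 0 = 1.
  have := H 0; rewrite normr0 => /(_ e0)[_].
  under eq_integral do rewrite mul0r expR0 mulr1.
  by rewrite w1 => -[].
have lb t : `|t| < e -> 1 + t * E <= M t.
  move=> /H[_ Mt]; rewrite -lee_fin -Mt EFinD EFinM -w1 -EE.
  rewrite -integralZl// -integralD//; last exact: integrableZl.
  apply: le_integral => //.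
  - by apply: integrableD => //; exact: integrableZl.
  - exact: wei.
  - move=> x _; rewrite -EFinM -EFinD lee_fin mulrCA -[X in X + _]mulr1 -mulrDr.
    by rewrite ler_wpM2l// expR_ge1Dx.
pose F : R -> R := M - E *: (id : R -> R).
have FD t : `|t| < e -> is_derive t (1 : R) F (dM t - E *: 1).
  by move=> /H[? _]; apply: is_deriveB.
have FE t : F t = M t - t * E by rewrite /F !fctE /= [t * E]mulrC.
have D0 : is_derive (0 : R) (1 : R) F 0.
  apply: (@derive1_at_min R F (- e) e) => [|t te| |t te].
  - by rewrite ge0_cp// ltW.
  - have /FD[] // : `|t| < e.
    by move: te; rewrite in_itv/= ltr_norml.
  - by rewrite in_itv/= oppr_lt0 e0.
  - rewrite !FE mul0r subr0 M0 lerBrDr; apply: lb.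
    by move: te; rewrite in_itv/= ltr_norml.
have D1 : is_derive (0 : R) (1 : R) F (dM 0 - E *: 1).
  by apply: FD; rewrite normr0.
have [_ e1] := D0; have [_ e2] := D1.
rewrite EE; congr EFin; apply/esym/eqP; rewrite -subr_eq0.
by move: e2; rewrite e1 /GRing.scale/= mulr1 => <-.
Qed.

End mean_of_mgf.

(** * Block structure and exponential tilting *)

Lemma expR_half_ln {R : realType} (x : R) : 0 < x ->
  expR (2^-1 * - ln x) = (Num.sqrt x)^-1.
Proof.
move=> x0; rewrite mulrN expRN; congr _^-1.
have e : x = expR (2^-1 * ln x) ^+ 2 by rewrite -expRM_natl mulVKf ?lnK.
by rewrite [in RHS]e sqrtr_sqr gtr0_norm// expR_gt0.
Qed.

Section blocks.
Context {R : realType} {N : nat} {p : 'I_N -> nat}.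
Local Notation n := (\sum_(i < N) p i)%N.

Lemma mul_mxdiag_mxdiag (A B : forall i, 'M[R]_(p i)) :
  \mxdiag_i A i *m \mxdiag_i B i = \mxdiag_i (A i *m B i).
Proof.
rewrite {2}/mxdiag mul_mxdiag_mxblock; apply: eq_mxblock => i j.
by case: eqVneq => [->|_]; rewrite ?conform_mx_id// mulmx0.
Qed.

Lemma submxblock1 i j : i != j -> submxblock (1%:M : 'M[R]_n) i j = 0.
Proof.
move=> ij; apply/matrixP => a b; rewrite !mxE -val_eqE tagnat.eq_Rank.
by rewrite (negbTE ij).
Qed.

Lemma submxblock1_diag i : submxblock (1%:M : 'M[R]_n) i i = 1%:M.
Proof. by apply/matrixP => a b; rewrite !mxE -val_eqE tagnat.eq_Rank eqxx. Qed.

Section posdef.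
Variable S : 'M[R]_n.
Hypothesis pS : posdefmx S.
Let D := \mxdiag_i submxblock S i i.
Let Dinv := \mxdiag_i invmx (submxblock S i i).
Let Gamma := S *m invmx D - 1%:M.

Lemma posdefmx_block i : posdefmx (submxblock S i i).
Proof. exact: posdefmx_sub (Rank_injective _ _) pS. Qed.

Lemma block_unit i : submxblock S i i \in unitmx.
Proof. exact: posdefmx_unit (posdefmx_block i). Qed.

Lemma invmx_mxdiag : invmx D = Dinv.
Proof.
have DD : D *m Dinv = 1%:M.
  rewrite /D /Dinv mul_mxdiag_mxdiag.
  under eq_mxdiag => i do rewrite (mulmxV (block_unit i)).
  exact: mxdiagZ.
have [uD _] := mulmx1_unit DD.
by rewrite -[LHS]mulmx1 -DD mulKmx.
Qed.

Lemma submxblock_Gamma i j : submxblock Gamma i j =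
  submxblock S i j *m invmx (submxblock S j j) - submxblock 1%:M i j.
Proof.
rewrite /Gamma submxblockB invmx_mxdiag -[S in S *m _]submxblockK.
by rewrite mul_mxblock_mxdiag mxblockK.
Qed.

Lemma Gamma_diag i : submxblock Gamma i i = 0.
Proof.
by rewrite submxblock_Gamma (mulmxV (block_unit i)) submxblock1_diag subrr.
Qed.

Lemma Gamma_offdiag i j : i != j -> submxblock Gamma i j =
  submxblock S i j *m invmx (submxblock S j j).
Proof. by move=> ij; rewrite submxblock_Gamma submxblock1// subr0. Qed.

Lemma mxtrace_Gamma : \tr Gamma = 0.
Proof.
rewrite -[Gamma]submxblockK mxtrace_mxblock big1// => i _.
by rewrite Gamma_diag mxtrace0.
Qed.

Lemma Dinv_sym : Dinv^T = Dinv.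
Proof.
rewrite /Dinv tr_mxdiag; apply: eq_mxdiag => i.
by rewrite trmx_inv (posdefmx_block i).1.
Qed.

Lemma qform_Dinv v :
  qform Dinv v = \sum_i qform (invmx (submxblock S i i)) (submxcol v i).
Proof.
rewrite /qform -{1 2}[v]submxcolK -mulmxA mul_mxdiag_mxcol tr_mxcol.
rewrite mul_mxrow_mxcol.
by rewrite summxE; apply: eq_bigr => i _; rewrite mulmxA.
Qed.

Definition log_quad (v : 'cV[R]_n) : R := - qform (invmx S - Dinv) v / 2.

Definition norm_ratio : R :=
  \prod_i Num.sqrt ((2 * pi) ^+ p i * \det (submxblock S i i)) /
  Num.sqrt ((2 * pi) ^+ n * \det S).

Let normalizer_gt0 k (M : 'M[R]_k) : posdefmx M ->
  0 < Num.sqrt ((2 * pi) ^+ k * \det M).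
Proof.
move=> pM; rewrite sqrtr_gt0 mulr_gt0 ?posdefmx_det_gt0//.
by rewrite exprn_gt0// mulr_gt0// pi_gt0.
Qed.

Lemma norm_ratio_gt0 : 0 < norm_ratio.
Proof.
rewrite divr_gt0 ?normalizer_gt0// prodr_gt0// => i _.
exact: normalizer_gt0 (posdefmx_block i).
Qed.

(** The normalising constants and the exponents separate; the block-diagonal
    form splits as the sum of the forms of the blocks. *)
Lemma gauss_ratio v :
  gauss S v / \prod_i gauss (submxblock S i i) (submxcol v i) =
  norm_ratio * expR (log_quad v).
Proof.
rewrite /gauss prodf_div/= -expR_sum /norm_ratio /log_quad invf_div.
rewrite [expR _ / _]mulrC mulrACA [_^-1 * \prod_(i < N) _]mulrC -expRN -expRD.
congr (_ * expR _).
rewrite qformB qform_Dinv.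
by rewrite -mulr_suml sumrN; ring.
Qed.

Lemma posdefmx_tilt : \forall t \near (0 : R),
  posdefmx (invmx S + t *: (invmx S - Dinv)).
Proof.
apply: posdefmx_near; first exact: posdefmx_inv.
by rewrite linearB/= trmx_inv pS.1 Dinv_sym.
Qed.

(** Multiplying by exp(t Q) changes the precision matrix from S^-1 to A, and the
    normalising constants of S and A^-1 differ by the square root of
    det(S A) = det(1 - t Gamma). *)
Lemma gauss_tilt t v : posdefmx (invmx S + t *: (invmx S - Dinv)) ->
  let A := invmx S + t *: (invmx S - Dinv) in
  gauss S v * expR (t * log_quad v) =
  expR (2^-1 * - ln (\det (1%:M - t *: Gamma))) * gauss (invmx A) v.
Proof.
move=> pA A; have uS := posdefmx_unit _ _ pS; have uA := posdefmx_unit _ _ pA.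
have SA : 1%:M - t *: Gamma = S *m A.
  rewrite /A /Gamma invmx_mxdiag mulmxDr -scalemxAr mulmxBr mulmxV//.
  by rewrite -scalerN opprB.
have dS := posdefmx_det_gt0 _ _ pS; have dA := posdefmx_det_gt0 _ _ pA.
rewrite SA det_mulmx.
rewrite /gauss invmxK mulrAC -expRD.
have -> : - qform (invmx S) v / 2 + t * log_quad v = - qform A v / 2.
  by rewrite /A qformD qformZ /log_quad; ring.
rewrite expR_half_ln ?mulr_gt0// [RHS]mulrCA -invfM -sqrtrM ?mulr_ge0 ?ltW//.
by rewrite det_inv mulrACA mulfV ?gt_eqF// mulr1 [\det S * _]mulrC.
Qed.

End posdef.
End blocks.

(** * The multiinformation density of a normal vector *)

Section multinormal_multiinfo.
Context {R : realType} {d : measure_display} {T : measurableType d}.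
Context (P : probability T R) {N : nat} {p : 'I_N -> nat}.
Local Notation n := (\sum_(i < N) p i)%N.
Context (X : {RV P >-> n.-tuple R}) (mu : 'cV[R]_n) (S : 'M[R]_n).
Hypotheses (pS : posdefmx S) (dX : multinormal P X mu S).
Variables (f : n.-tuple R -> R) (fn : forall i : 'I_N, (p i).-tuple R -> R).
Hypotheses (df : is_density P X f)
  (dfn : forall i, is_density P (subvec p i \o X) (fn i)).

Let Gamma := S *m invmx (\mxdiag_(i < N) submxblock S i i) - 1%:M.
Let w := multinormal_pdf mu S.
Let q x := log_quad S (col_of_tuple x - mu).
Let M t := expR (2^-1 * - ln (\det (1%:M - t *: Gamma))).

Let mw : measurable_fun setT w := measurable_multinormal_pdf _ _ _.

Let w_gt0 x : 0 < w x. Proof. exact: multinormal_pdf_gt0. Qed.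

Let mq : measurable_fun setT q.
Proof.
apply: measurable_funM => //; apply: measurableT_comp => //.
exact: measurable_qform.
Qed.

Lemma mgf_log_quad : \forall t \near (0 : R),
  (\int[lebesgue_tuple n]_x (w x * expR (t * q x))%:E = (M t)%:E)%E.
Proof.
apply: filterS (posdefmx_tilt S pS) => t pA.
have pAi := posdefmx_inv _ _ pA.
set A := invmx S + _ in pA pAi.
have wE x : (w x * expR (t * q x))%:E =
    ((M t)%:E * (multinormal_pdf mu (invmx A) x)%:E)%E.
  by rewrite -EFinM; congr EFin; exact: gauss_tilt.
under eq_integral do rewrite wE.
rewrite ge0_integralZl_EFin ?expR_ge0//.
- by rewrite integral_multinormal_pdf// mule1.
- by move=> x _; rewrite lee_fin ltW// multinormal_pdf_gt0.
- exact: emeasurable_multinormal_pdf.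
Qed.

Lemma mean_log_quad :
  (lebesgue_tuple n).-integrable setT (fun x => (w x * q x)%:E) /\
  (\int[lebesgue_tuple n]_x (w x * q x)%:E = 0)%E.
Proof.
have w0 x : 0 <= w x by exact: ltW.
have w1 : (\int[lebesgue_tuple n]_x (w x)%:E = 1)%E.
  exact: integral_multinormal_pdf.
have Mder : \forall t \near (0 : R), is_derive t (1 : R) M
    (M t * (2^-1 * \tr (invmx (1%:M - t *: Gamma) *m Gamma))).
  by apply: filterS (det_near_gt0 Gamma) => t; exact: is_derive_logdet_mgf.
have iq := @mgf_integrable _ _ _ (lebesgue_tuple n) w q M mw w0 mq mgf_log_quad.
split; first exact: iq.
have -> := @mean_of_mgf _ _ _ (lebesgue_tuple n) w q M _ mw w0 mq w1 Mder
  mgf_log_quad.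
by rewrite scale0r subr0 invmx1 mul1mx mxtrace_Gamma ?mulr0.
Qed.

(** The law of a subvector has a density, so that it does not charge the
    exceptional set B; since the joint density is everywhere positive, the
    preimage of B is Lebesgue-null. *)
Lemma ae_subvec i (Q : set ((p i).-tuple R)) :
  {ae lebesgue_tuple (p i), forall y, Q y} ->
  {ae lebesgue_tuple n, forall x, Q (subvec p i x)}.
Proof.
move=> [B [mB B0 QB]].
have mB' : measurable (subvec p i @^-1` B).
  by rewrite -[X in measurable X]setTI; exact: measurable_subvec.
exists (subvec p i @^-1` B); split => //; last first.
  by move=> x /= nQ; exact: QB.
have [mfn fn0 fnA] := dfn i.
have PB : P (X @^-1` (subvec p i @^-1` B)) = 0%E.
  have := fnA _ mB; rewrite null_set_integral//.
  by apply/measurable_EFinP; exact: measurable_funTS.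
have [_ _ wA] := dX.
have wB : (\int[lebesgue_tuple n]_(x in subvec p i @^-1` B) (w x)%:E = 0)%E.
  by rewrite -wA// -PB.
have mwB : measurable_fun (subvec p i @^-1` B) (EFin \o w).
  by apply/measurable_EFinP; exact: measurable_funTS.
have [+ _] := @ae_eq_integral_abs _ _ _ (lebesgue_tuple n) _ mB' _ mwB.
under eq_integral do rewrite /= ger0_norm ?(ltW (w_gt0 _))//.
move=> /(_ wB) [C [mC C0 wC]].
apply: (subset_measure0 mB' mC _ C0) => x Bx; apply: wC => /= /(_ Bx)[].
by apply/eqP; rewrite gt_eqF.
Qed.

Lemma ae_density_ratio : {ae lebesgue_tuple n, forall x,
  f x = w x /\ log_ratio f fn x = ln (norm_ratio S) + q x}.
Proof.
have fw : {ae lebesgue_tuple n, forall x, f x = w x}.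
  have := density_ae_eq P X _ _ df dX.
  by apply: filterS => x /(_ I).
have fnw : {ae lebesgue_tuple n, forall x, forall i, fn i (subvec p i x) =
    multinormal_pdf (submxcol mu i) (submxblock S i i) (subvec p i x)}.
  apply: filter_forall => i; apply: (ae_subvec i (fun y => fn i y = _ y)).
  have := density_ae_eq P _ _ _ (dfn i) (marginal_density P p X mu S i pS dX).
  by apply: filterS => x /(_ I).
apply: filterS2 fw fnw => x fx fnx; split => //.
rewrite /log_ratio fx; under eq_bigr do rewrite fnx.
have -> : \prod_(i < N)
      multinormal_pdf (submxcol mu i) (submxblock S i i) (subvec p i x) =
    \prod_i gauss (submxblock S i i) (submxcol (col_of_tuple x - mu) i).
  apply: eq_bigr => i _.
  rewrite -[LHS]/(gauss _ (col_of_tuple (subvec p i x) - _)).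
  by rewrite subvec_col; congr gauss; apply/matrixP => a b; rewrite !mxE.
rewrite -[w x]/(gauss S (col_of_tuple x - mu)) gauss_ratio//.
rewrite lnM ?posrE ?expR_gt0 ?norm_ratio_gt0//.
by rewrite expRK.
Qed.

Lemma measurable_log_ratio : measurable_fun setT (log_ratio f fn).
Proof.
have [mf _ _] := df.
apply: measurableT_comp => //; apply: measurable_funM => //.
have f0 x : 0 <= \prod_(i < N) fn i (subvec p i x).
  by apply: prodr_ge0 => i _; have [] := dfn i.
(* The real power is a measurable function and is the inverse on [0, +oo[. *)
have -> : (fun x => (\prod_(i < N) fn i (subvec p i x))^-1) =
    (fun x => (\prod_(i < N) fn i (subvec p i x)) `^ (-1)).
  by apply/funext => x; rewrite powR_inv1.
have mprod : measurable_fun setT (fun x => \prod_(i < N) fn i (subvec p i x)).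
  apply: measurable_prod => i _.
  apply: measurableT_comp; last exact: measurable_subvec.
  by have [] := dfn i.
exact: (measurableT_comp (measurable_powR (-1)) mprod).
Qed.

(** The logarithmic ratio is a constant plus a quadratic form of mean zero. *)
Lemma multiinfoE : multiinfo f fn = (ln (norm_ratio S))%:E.
Proof.
have [iq q0] := mean_log_quad; have [mf f0 _] := df.
have wi : (lebesgue_tuple n).-integrable setT (fun x => (w x)%:E).
  exact: density_integrable dX.
transitivity (\int[lebesgue_tuple n]_x
    ((ln (norm_ratio S))%:E * (w x)%:E + (w x * q x)%:E))%E.
  apply: ae_eq_integral => //.
  - apply/measurable_EFinP; apply: measurable_funM => //.
    exact: measurable_log_ratio.
  - apply: emeasurable_funD; last exact: measurable_int iq.
    by apply: emeasurable_funM => //; exact: measurable_int wi.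
  - apply: filterS ae_density_ratio => x [-> ->] _.
    by rewrite mulrDr EFinD [w x * _]mulrC EFinM.
rewrite integralD//; last exact: integrableZl.
by rewrite q0 adde0 integralZl// integral_multinormal_pdf// mule1.
Qed.

Lemma cgf_multiinfo_density : \forall t \near (0 : R),
  cgf P (multiinfo_density f fn X) t =
  (t * ln (norm_ratio S) - 2^-1 * ln (\det (1%:M - t *: Gamma)))%:E.
Proof.
apply: filterS mgf_log_quad => t Mt.
rewrite /cgf /mmt_gen_fun unlock.
have [mf f0 _] := df.
have mh : measurable_fun setT (fun x => (expR (t * log_ratio f fn x))%:E).
  apply/measurable_EFinP; apply: measurableT_comp => //.
  by apply: measurable_funM => //; exact: measurable_log_ratio.
have mwt : measurable_fun setT (fun x => (w x * expR (t * q x))%:E).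
  apply/measurable_EFinP; apply: measurable_funM => //.
  by apply: measurableT_comp => //; exact: measurable_funM.
have -> : (\int[P]_w0 ((expR \o t \o* multiinfo_density f fn X) w0)%:E =
    (expR (t * ln (norm_ratio S)) * M t)%:E)%E.
  rewrite [LHS](_ : _ =
      \int[P]_w0 (expR (t * log_ratio f fn (X w0)))%:E)%E; last first.
    by apply: eq_integral => x _; rewrite /= mulrC.
  rewrite (expectation_density P X f
    (fun x => (expR (t * log_ratio f fn x))%:E) df mh); last first.
    by move=> x; rewrite lee_fin expR_ge0.
  rewrite EFinM -Mt -ge0_integralZl_EFin ?expR_ge0//; last first.
    by move=> x _; rewrite lee_fin mulr_ge0 ?expR_ge0 ?(ltW (w_gt0 _)).
  apply: ae_eq_integral => //.
  - by apply: emeasurable_funM => //; exact/measurable_EFinP.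
  - exact: emeasurable_funM.
  - apply: filterS ae_density_ratio => x [-> ->] _.
    by rewrite mulrDr expRD -!EFinM mulrCA.
rewrite lne_EFin ?mulr_gt0 ?expR_gt0//.
by rewrite lnM ?posrE ?expR_gt0// !expRK mulrN.
Qed.

End multinormal_multiinfo.

(** * Cumulants *)

Section cumulants.
Context {d} {T : measurableType d} {R : realType} (P : probability T R).
Variables (Y : T -> R).

Lemma cumulants_unique k k' : cumulants P Y k -> cumulants P Y k' ->
  forall l, (0 < l)%N -> k l = k' l.
Proof.
move=> ck ck' l l0.
have H : \forall t \near (0 : R), (fun n => \sum_(1 <= l < n)
    (k l - k' l) / l`!%:R * t ^+ l) @ \oo --> (0 : R).
  apply: filterS2 ck ck' => t [_ h] [_ h'].
  rewrite (_ : (fun n => _) = (fun n =>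
      \sum_(1 <= l < n) k l * t ^+ l / l`!%:R -
      \sum_(1 <= l < n) k' l * t ^+ l / l`!%:R)); last first.
    apply/funext => n; rewrite -sumrB; apply: eq_bigr => i _.
    by rewrite -mulrBl -mulrBl mulrAC.
  by rewrite -[X in _ --> X](subrr (fine (cgf P Y t))); exact: cvgB.
have /eqP := @power_series_eq0 R _ H l l0.
rewrite mulf_eq0 invr_eq0 pnatr_eq0 eqn0Ngt fact_gt0 orbF subr_eq0.
by move/eqP.
Qed.

(** Since (l - 1)! / l! = 1 / l, the sequence in question is half the
    logarithmic series, with the first term replaced by c; nothing is lost
    because tr G = 0. *)
Lemma cumulants_logdet n (G : 'M[R]_n) c : \tr G = 0 ->
  (\forall t \near (0 : R), cgf P Y t =
    (t * c - 2^-1 * ln (\det (1%:M - t *: G)))%:E) ->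
  cumulants P Y
    (fun l => if l == 1%N then c else (l.-1)`!%:R / 2 * \tr (G ^+ l)).
Proof.
move=> G0 cgfE; apply: filterS2 cgfE (logdet_series G) => t -> h; split => //.
rewrite (_ : (fun m => _) = (fun m =>
    \sum_(1 <= l < m) (if l == 1%N then t * c else 0) +
    2^-1 * trace_sum G m t)); last first.
  apply/funext => m; rewrite /trace_sum mulr_sumr -big_split/= !big_nat.
  apply: eq_bigr => -[//|l] _; case: l => [|l] /=.
    by rewrite !expr1 G0 !mul0r mulr0 addr0 divr1 mulrC.
  rewrite add0r [(l.+2)`!]factS natrM; move: (\tr _) (t ^+ _) => a b; field.
  by rewrite -natrD !pnatr_eq0 !eqn0Ngt fact_gt0.
rewrite /= -mulrN; apply: cvgD; last exact: cvgMr.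
apply: cvg_near_cst; near=> m.
rewrite big_ltn; last by near: m; exact: nbhs_infty_gt.
by rewrite eqxx big_nat big1 ?addr0// => -[|[|]].
Unshelve. all: by end_near. Qed.

End cumulants.

Theorem theorem1 (R : realType) (d : measure_display) (T : measurableType d)
    (P : probability T R) (N : nat) (hN : (2 <= N)%N)
    (p : 'I_N -> nat) (hp : forall n, (0 < p n)%N)
    (X : {RV P >-> (\sum_(n < N) p n).-tuple R})
    (mu : 'cV[R]_(\sum_(n < N) p n)) (Sigma : 'M[R]_(\sum_(n < N) p n))
    (hSigma : posdefmx Sigma) (hX : multinormal P X mu Sigma)
    (f : (\sum_(n < N) p n).-tuple R -> R) (hf : is_density P X f)
    (fn : forall n : 'I_N, (p n).-tuple R -> R)
    (hfn : forall n : 'I_N,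
       is_density P (subvec p n \o X) (fn n)) :
  let i_d := multiinfo_density f fn X in
  let I := multiinfo f fn in
  let Gamma := Sigma *m invmx (\mxdiag_(n < N) submxblock Sigma n n) - 1%:M in
  [/\ (forall n, submxblock Gamma n n = 0) /\
      (forall m n, m != n ->
         submxblock Gamma m n =
           submxblock Sigma m n *m invmx (submxblock Sigma n n)),
      \forall t \near (0 : R),
        cgf P i_d t =
          (t%:E * I - (2^-1 * ln (\det (1%:M - t *: Gamma)))%:E)%E,
      exists k : nat -> R, cumulants P i_d k
    & forall k : nat -> R, cumulants P i_d k ->
        (k 1%N)%:E = I /\
        forall l, (2 <= l)%N -> k l = (l.-1)`!%:R / 2 * \tr (Gamma ^+ l)].
Proof.
move=> i_d I Gamma.
have IE : I = (ln (norm_ratio Sigma))%:E.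
  exact: multiinfoE hSigma hX _ _ hf hfn.
have cgfE := cgf_multiinfo_density P X mu Sigma hSigma hX f fn hf hfn.
have cums : cumulants P i_d (fun l => if l == 1%N then ln (norm_ratio Sigma)
    else (l.-1)`!%:R / 2 * \tr (Gamma ^+ l)).
  by apply: cumulants_logdet => //; exact: mxtrace_Gamma.
split.
- by split=> [i|i j]; [exact: Gamma_diag|exact: Gamma_offdiag].
- by apply: filterS cgfE => t ->; rewrite IE EFinD EFinM EFinN.
- by exists (fun l => if l == 1%N then ln (norm_ratio Sigma)
    else (l.-1)`!%:R / 2 * \tr (Gamma ^+ l)).
- move=> k ck; have kE := cumulants_unique P _ _ _ ck cums.
  split; first by rewrite kE.
  by move=> [|[|l]]// _; rewrite kE.
Qed.
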